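(* Let $(S,\theta)$ be an ID-simple ring with field of constants $C$ and let $R/S$ be a PV-extension. Then the group functor $\underline{\mathrm{Aut}}^{ID}(R/S)$ on $C$-algebras is represented by $\mathcal G:=\mathrm{Spec}(C_{R\otimes_S R})$, where $C_{R\otimes_S R}$ is the ring of constants of $R\otimes_S R$; thus $\mathcal G\cong\underline{\mathrm{Aut}}^{ID}(R/S)$ is an affine group scheme of finite type over $C$.
   Context: All rings are commutative with unit and nonzero. An iterative derivation on a ring $R$ is a ring homomorphism $\theta:R\to R[[T]]$, written $\theta(r)=\sum_{i\ge 0}\theta^{(i)}(r)T^i$, with $\theta^{(0)}=\mathrm{id}_R$ and $\theta^{(i)}\circ\theta^{(j)}=\binom{i+j}{i}\theta^{(i+j)}$ for all $i,j\ge 0$; then $(R,\theta)$ is an ID-ring. Its ring of constants is $C_R=\{r\in R\mid \theta(r)=r\}$. An ideal $I$ of $R$ is an ID-ideal if $\theta(I)\subseteq I[[T]]$; $R$ is ID-simple if its only ID-ideals are $\{0\}$ and $R$ (the constants of an ID-simple ring form a field). A homomorphism of ID-rings is a ring homomorphism commuting with all $\theta^{(n)}$. Tensor products carry $\theta^{(k)}(a\otimes b)=\sum_{i+j=k}\theta^{(i)}(a)\otimes\theta^{(j)}(b)$. An ID-module $(M,\theta_M)$ over an ID-ring $R$ is a finitely generated $R$-module $M$ with an additive map $\theta_M:M\to M[[T]]$, $\theta_M(m)=\sum_i\theta_M^{(i)}(m)T^i$, such that $\theta_M(rm)=\theta(r)\theta_M(m)$, $\theta_M^{(0)}=\mathrm{id}_M$,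 $\theta_M^{(i)}\circ\theta_M^{(j)}=\binom{i+j}{i}\theta_M^{(i+j)}$. It is trivial if it has a finite $R$-basis of constant elements ($\theta_M(m)=m$). Let $M$ be an ID-module over the ID-simple ring $S$ with constants $C$. A solution ring for $M$ is an ID-simple ring $R$ with a homomorphism of ID-rings $f:S\to R$ (automatically injective) such that $C_R=f(C)$ and $R\otimes_S M$ is a trivial ID-module over $R$. A Picard-Vessiot ring (PV-ring) for $M$ is a solution ring $(R,f)$ that is minimal: for every solution ring $(\tilde R,\tilde f)$ for $M$, every ID-homomorphism $g:\tilde R\to R$ with $g\circ\tilde f=f$ is an isomorphism. A PV-extension $R/S$ is an ID-ring extension such that $R$ is a PV-ring for some ID-module over $S$. For a $C$-algebra $D$ equipped with the trivial iterative derivation ($\theta(d)=d$), $\underline{\mathrm{Aut}}^{ID}(R/S)(D)$ is the group of $(S\otimes_C D)$-linear ID-ring automorphisms of $R\otimes_C D$. *)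

(* Defs.v *)
From HB Require Import structures.
From mathcomp Require Import all_boot all_order all_algebra.
From mathcomp Require Import boolp zify.

Set Implicit Arguments.
Unset Strict Implicit.
Unset Printing Implicit Defensive.

Import GRing.Theory.
Local Open Scope ring_scope.
Local Open Scope quotient_scope.

(* The coefficient of T^n in a product of power series: the sum of G i j over
   i + j = n. *)
Definition cauchy (V : nmodType) (n : nat) (G : nat -> nat -> V) : V :=
  \sum_(i < n.+1) G i (n - i)%N.

Section Cauchy.
Variable V : zmodType.
Implicit Types (n k l : nat) (G : nat -> nat -> V).

Lemma eq_cauchy n G H :
  (forall i j, (i + j)%N = n -> G i j = H i j) -> cauchy n G = cauchy n H.
Proof.
by move=> GH; apply: eq_bigr => i _; apply: GH; rewrite subnKC // -ltnS.
Qed.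

Lemma cauchyD n G H :
  cauchy n (fun i j => G i j + H i j) = cauchy n G + cauchy n H.
Proof. by rewrite /cauchy big_split. Qed.

Lemma cauchyC n G : cauchy n G = cauchy n (fun i j => G j i).
Proof.
rewrite /cauchy (reindex_inj rev_ord_inj) /=; apply: eq_bigr => i _.
by rewrite subSS subKn // -ltnS.
Qed.

Lemma cauchy_sum (I : Type) (r : seq I) n (G : I -> nat -> nat -> V) :
  cauchy n (fun i j => \sum_(k <- r) G k i j) = \sum_(k <- r) cauchy n (G k).
Proof. by rewrite /cauchy exchange_big. Qed.

Lemma cauchyA n (F : nat -> nat -> nat -> V) :
  cauchy n (fun m k => cauchy m (fun i j => F i j k)) =
  cauchy n (fun i m => cauchy m (fun j k => F i j k)).
Proof.
rewrite /cauchy.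
transitivity (\sum_(m < n.+1) \sum_(i < n.+1 | (i <= m)%N) F i (m - i)%N (n - m)%N).
  apply: eq_bigr => m _.
  by rewrite (big_ord_widen n.+1 (fun i => F i (m - i)%N (n - m)%N)) ?ltn_ord.
rewrite (exchange_big_dep xpredT) //=; apply: eq_bigr => i _.
have lin : (i <= n)%N by rewrite -ltnS.
rewrite -[LHS](big_mkord (fun m => i <= m)%N (fun m => F i (m - i)%N (n - m)%N)).
rewrite (big_cat_nat _ (n := i)) //=; last exact: ltnW.
rewrite big_nat_cond big_pred0 ?add0r; last first.
  by move=> m; rewrite leq0n /= andbC leqNgt; case: ltnP.
rewrite -{1}[i : nat]add0n big_addn subSn // big_mkord.
rewrite [LHS](eq_bigl xpredT) => [|j]; last by rewrite leq_addl.
by apply: eq_bigr => j _; rewrite addnK addnC subnDA.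
Qed.

Lemma cauchyACA n (F : nat -> nat -> nat -> nat -> V) :
  cauchy n (fun u v => cauchy u (fun i j => cauchy v (fun k l => F i j k l))) =
  cauchy n (fun u v => cauchy u (fun i k => cauchy v (fun j l => F i j k l))).
Proof.
rewrite !(cauchyA _ (fun i j v => cauchy v (fun k l => _))).
apply: eq_cauchy => i m _.
rewrite -(cauchyA _ (fun j k l => F i j k l)) -(cauchyA _ (fun k j l => F i j k l)).
by apply: eq_cauchy => p l _; rewrite cauchyC.
Qed.

Lemma cauchy_bin k l G :
  cauchy k (fun i j => cauchy l (fun p q =>
    G (i + p)%N (j + q)%N *+ ('C(i + p, i) * 'C(j + q, j)))) =
  cauchy (k + l) G *+ 'C(k + l, k).
Proof.
rewrite /cauchy.
transitivity (\sum_(i < k.+1) \sum_(u < (k + l).+1)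
   G u (k + l - u)%N *+ ('C(u, i) * 'C(k + l - u, k - i))).
  apply: eq_bigr => i _.
  have lik : (i <= k)%N by rewrite -ltnS.
  rewrite -(big_mkord xpredT
    (fun u => G u (k + l - u)%N *+ ('C(u, i) * 'C(k + l - u, k - i)))).
  rewrite (big_cat_nat _ (n := i)) //=; last first.
    by rewrite ltnW // ltnS (leq_trans lik) ?leq_addr.
  rewrite [X in _ = X + _]big_nat [X in _ = X + _]big1 ?add0r => [|u /andP[_ ui]];
    last by rewrite bin_small.
  rewrite (big_cat_nat _ (n := i + l.+1)) //=; last 2 first.
  - by rewrite leq_addr.
  - by rewrite addnS ltnS leq_add2r.
  rewrite [X in _ = _ + X]big_nat [X in _ = _ + X]big1 ?addr0; last first.
    move=> u /andP[lu uk]; rewrite (@bin_small (k + l - u)) ?muln0 //.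
    move: lu uk; rewrite addnS ltnS => lu uk.
    clear -lik lu uk; move: (i : nat) lik lu => j; lia.
  rewrite -[X in index_iota X _]add0n big_addn addKn big_mkord.
  apply: eq_bigr => p _; rewrite (addnC p).
  have lp : (p <= l)%N by rewrite -ltnS.
  have -> : (k - i + (l - p) = k + l - (i + p))%N.
    by clear -lik lp; move: (i : nat) (p : nat) lik lp => a b; lia.
  by [].
rewrite exchange_big -sumrMnl /=; apply: eq_bigr => u _.
rewrite sumrMnr binomial.Vandermonde subnKC //.
by rewrite -ltnS.
Qed.
End Cauchy.

(* M (x)_K N is the free commutative monoid on M * N (finite sequences up to
   permutation) modulo biadditivity and K-balancedness; tens_zerol makes the
   quotient a group, the opposite of m (x) n being (- m) (x) n.
   Its universal property is tens_lift_pure, tens_liftD and tens_ind. *)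
Section Tensor.
Variables (K : comNzRingType) (M N : lmodType K).

Inductive tens_rel : seq (M * N) -> seq (M * N) -> Prop :=
| tens_refl s : tens_rel s s
| tens_sym s t : tens_rel s t -> tens_rel t s
| tens_trans s t u : tens_rel s t -> tens_rel t u -> tens_rel s u
| tens_cat s s' t t' :
    tens_rel s s' -> tens_rel t t' -> tens_rel (s ++ t) (s' ++ t')
| tens_comm s t : tens_rel (s ++ t) (t ++ s)
| tens_zerol n : tens_rel [:: (0, n)] [::]
| tens_addl m m' n : tens_rel [:: (m + m', n)] [:: (m, n); (m', n)]
| tens_addr m n n' : tens_rel [:: (m, n + n')] [:: (m, n); (m, n')]
| tens_balanced a m n : tens_rel [:: (a *: m, n)] [:: (m, a *: n)].

Definition tens_relb s t := `[< tens_rel s t >].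

Lemma tens_relb_refl : reflexive tens_relb.
Proof. by move=> s; apply/asboolP; exact: tens_refl. Qed.

Lemma tens_relb_sym : symmetric tens_relb.
Proof. by move=> s t; apply/asboolP/asboolP; exact: tens_sym. Qed.

Lemma tens_relb_trans : transitive tens_relb.
Proof.
by move=> t s u /asboolP st /asboolP tu; apply/asboolP; exact: tens_trans st tu.
Qed.

Definition tens_equiv :=
  EquivRel tens_relb tens_relb_refl tens_relb_sym tens_relb_trans.
Canonical tens_equiv.

Definition tens := {eq_quot tens_relb}.
HB.instance Definition _ := Choice.on tens.
HB.instance Definition _ := EqQuotient.on tens.

Definition tens_class (s : seq (M * N)) : tens := \pi_tens s.

Lemma tens_classP s t : tens_class s = tens_class t <-> tens_rel s t.
Proof.
by split=> [/eqmodP/asboolP//|st]; apply/eqmodP/asboolP.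
Qed.

Lemma tens_class_repr (x : tens) : tens_class (repr x) = x.
Proof. exact: reprK. Qed.

Lemma repr_tens_class s : tens_rel (repr (tens_class s)) s.
Proof. by apply/tens_classP; rewrite tens_class_repr. Qed.

Definition tens_add (x y : tens) := tens_class (repr x ++ repr y).
Definition tens_opp (x : tens) := tens_class [seq (- p.1, p.2) | p <- repr x].

Lemma tens_class_cat s t :
  tens_class (s ++ t) = tens_add (tens_class s) (tens_class t).
Proof.
by apply/tens_classP/tens_cat; apply: tens_sym; apply: repr_tens_class.
Qed.

Fact tens_addA : associative tens_add.
Proof.
move=> x y z.
rewrite -(tens_class_repr x) -(tens_class_repr y) -(tens_class_repr z).
by rewrite -!tens_class_cat catA.
Qed.

Fact tens_addC : commutative tens_add.
Proof. by move=> x y; apply/tens_classP; exact: tens_comm. Qed.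

Fact tens_add0 : left_id (tens_class [::]) tens_add.
Proof.
by move=> x; rewrite -[in LHS](tens_class_repr x) -tens_class_cat tens_class_repr.
Qed.

Fact tens_addN : left_inverse (tens_class [::]) tens_opp tens_add.
Proof.
move=> x; rewrite /tens_opp -[in X in tens_add _ X](tens_class_repr x) -tens_class_cat.
elim: (repr x) => [//|[m n] s IHs] /=; rewrite -cat1s tens_class_cat.
rewrite [tens_class (_ ++ _)]tens_class_cat -[_ :: s]cat1s.
rewrite [X in tens_add _ (tens_add _ X)]tens_class_cat.
rewrite [X in tens_add _ X]tens_addA [X in tens_add _ (tens_add X _)]tens_addC.
rewrite -[X in tens_add _ X]tens_addA -[X in tens_add _ (tens_add _ X)]tens_class_cat IHs.
rewrite -!tens_class_cat cats0; apply/tens_classP.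
apply: tens_trans (tens_zerol n).
by rewrite -(addNr m); apply/tens_sym/tens_addl.
Qed.

HB.instance Definition _ :=
  GRing.isZmodule.Build tens tens_addA tens_addC tens_add0 tens_addN.

Definition pure (m : M) (n : N) : tens := tens_class [:: (m, n)].

Lemma pureDl n : {morph pure^~ n : m m' / m + m'}.
Proof.
move=> m m'; rewrite [LHS](_ : _ = tens_class ([:: (m, n)] ++ [:: (m', n)])).
  exact: tens_class_cat.
exact/tens_classP/tens_addl.
Qed.

Lemma pureDr m : {morph pure m : n n' / n + n'}.
Proof.
move=> n n'; rewrite [LHS](_ : _ = tens_class ([:: (m, n)] ++ [:: (m, n')])).
  exact: tens_class_cat.
exact/tens_classP/tens_addr.
Qed.

Lemma pureZ a m n : pure (a *: m) n = pure m (a *: n).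
Proof. exact/tens_classP/tens_balanced. Qed.

Lemma pure0l n : pure 0 n = 0.
Proof. exact/tens_classP/tens_zerol. Qed.

Lemma pure0r m : pure m 0 = 0.
Proof. by rewrite -(scale0r 0) -pureZ scale0r pure0l. Qed.

Lemma pureMnl m n k : pure (m *+ k) n = pure m n *+ k.
Proof. by elim: k => [|k IHk]; rewrite ?mulr0n ?pure0l // !mulrS pureDl IHk. Qed.

Lemma pureMnr m n k : pure m (n *+ k) = pure m n *+ k.
Proof. by elim: k => [|k IHk]; rewrite ?mulr0n ?pure0r // !mulrS pureDr IHk. Qed.

Lemma pure_suml n (I : Type) (r : seq I) (P : pred I) (F : I -> M) :
  pure (\sum_(i <- r | P i) F i) n = \sum_(i <- r | P i) pure (F i) n.
Proof. by rewrite (big_morph (pure^~ n) (pureDl n) (pure0l n)). Qed.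

Lemma pure_sumr m (I : Type) (r : seq I) (P : pred I) (F : I -> N) :
  pure m (\sum_(i <- r | P i) F i) = \sum_(i <- r | P i) pure m (F i).
Proof. by rewrite (big_morph (pure m) (pureDr m) (pure0r m)). Qed.

Lemma tens_classE s : tens_class s = \sum_(p <- s) pure p.1 p.2.
Proof.
elim: s => [|[m n] s IHs]; first by rewrite big_nil.
by rewrite big_cons -IHs -[_ :: s]cat1s; apply: tens_class_cat.
Qed.

Lemma tens_ind (P : tens -> Prop) :
  (forall m n, P (pure m n)) -> (forall x y, P x -> P y -> P (x + y)) ->
  forall x, P x.
Proof.
move=> Ppure PD x; rewrite -(tens_class_repr x) tens_classE.
by elim/big_ind: _ => //; rewrite -(pure0l 0).
Qed.

Section Lift.
Variables (V : zmodType).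

Definition balanced_map (h : M -> N -> V) : Prop :=
  [/\ forall n, {morph h^~ n : m m' / m + m'},
      forall m, {morph h m : n n' / n + n'}
    & forall a m n, h (a *: m) n = h m (a *: n)].

Definition tens_lift (h : M -> N -> V) (x : tens) : V :=
  \sum_(p <- repr x) h p.1 p.2.

Variables (h : M -> N -> V) (hP : balanced_map h).

Lemma tens_rel_sum s t :
  tens_rel s t -> \sum_(p <- s) h p.1 p.2 = \sum_(p <- t) h p.1 p.2.
Proof.
case: hP => hDl hDr hZ.
have h0 n : h 0 n = 0 by apply: (addIr (h 0 n)); rewrite -hDl !add0r.
elim=> {s t} //.
- by move=> s t u _ -> _ ->.
- by move=> s s' t t' _ IHs _ IHt; rewrite !big_cat IHs IHt.
- by move=> s t; rewrite !big_cat /= addrC.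
- by move=> n; rewrite big_seq1 big_nil h0.
- by move=> m m' n; rewrite !(big_cons, big_nil) /= !addr0 hDl.
- by move=> m n n'; rewrite !(big_cons, big_nil) /= !addr0 hDr.
- by move=> a m n; rewrite !big_seq1 hZ.
Qed.

Lemma tens_lift_class s : tens_lift h (tens_class s) = \sum_(p <- s) h p.1 p.2.
Proof. exact/tens_rel_sum/repr_tens_class. Qed.

Lemma tens_lift_pure m n : tens_lift h (pure m n) = h m n.
Proof. by rewrite tens_lift_class big_seq1. Qed.

Lemma tens_liftD : {morph tens_lift h : x y / x + y}.
Proof. by move=> x y; rewrite [x + y]/(tens_add x y) tens_lift_class big_cat. Qed.

End Lift.
End Tensor.

(* theta(x) is the power series whose T^n-coefficient is ider n x.  Additivity,
   multiplicativity and semilinearity of theta are stated coefficientwise. *)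
HB.mixin Record hasIterDer V of GRing.Zmodule V := {
  ider : nat -> V -> V;
  iderD : forall n, {morph ider n : x y / x + y};
  ider0n : forall x, ider 0%N x = x;
  ider_comp : forall i j x, ider i (ider j x) = ider (i + j)%N x *+ 'C(i + j, i)
}.

#[short(type="iterZmodType")]
HB.structure Definition IterZmod := {V of GRing.Zmodule V & hasIterDer V}.

HB.mixin Record isIDRing R of GRing.ComPzRing R & hasIterDer R := {
  ider1 : forall n, ider n (1 : R) = (n == 0%N)%:R;
  iderM : forall n (x y : R),
    ider n (x * y) = cauchy n (fun i j => ider i x * ider j y)
}.

(* The trivial ring is allowed here because a tensor product of two nonzero
   algebras can vanish; idRingType excludes it. *)
#[short(type="idPzRingType")]
HB.structure Definition IDPzRing :=
  {R of GRing.ComPzRing R & IterZmod R & isIDRing R}.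

#[short(type="idRingType")]
HB.structure Definition IDRing := {R of GRing.ComNzRing R & IDPzRing R}.

HB.mixin Record isIDLmod (K : idRingType) M
    of GRing.Lmodule K M & hasIterDer M := {
  iderZ : forall n (a : K) (m : M),
    ider n (a *: m) = cauchy n (fun i j => ider i a *: ider j m)
}.

#[short(type="idLmodType")]
HB.structure Definition IDLmod (K : idRingType) :=
  {M of GRing.Lmodule K M & IterZmod M & isIDLmod K M}.

(* A pair (A, f) of a nonzero ID-ring A and an ID-ring homomorphism f : K -> A:
   here f k = k%:A, and iderZ at m = 1 says that f commutes with theta (see
   ider_alg).  Ring homomorphisms under K are {lrmorphism _ -> _}. *)
#[short(type="idAlgType")]
HB.structure Definition IDAlg (K : idRingType) :=
  {A of GRing.ComAlgebra K A & IDRing A & IDLmod K A}.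

HB.mixin Record isFinGen (K : pzRingType) M of GRing.Lmodule K M := {
  fin_gen : exists (n : nat) (v : 'I_n -> M),
    forall m, exists c : 'I_n -> K, m = \sum_i c i *: v i
}.

#[short(type="idModType")]
HB.structure Definition IDModule (K : idRingType) :=
  {M of IDLmod K M & isFinGen K M}.

Section IterZmodTheory.
Variable V : iterZmodType.

Lemma ider_0 n : ider n (0 : V) = 0.
Proof. by apply: (addIr (ider n 0)); rewrite -iderD !add0r. Qed.

Lemma iderN n : {morph ider n : x / - x : V}.
Proof. by move=> x; apply: (addrI (ider n x)); rewrite -iderD !subrr ider_0. Qed.

Lemma ider_sum n (I : Type) (r : seq I) (P : pred I) (F : I -> V) :
  ider n (\sum_(i <- r | P i) F i) = \sum_(i <- r | P i) ider n (F i).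
Proof. by rewrite (big_morph (ider n) (iderD n) (ider_0 n)). Qed.
End IterZmodTheory.

Section TensorIter.
Variables (K : idRingType) (M N : idLmodType K).

Definition tens_ider (n : nat) : tens M N -> tens M N :=
  tens_lift (fun a b => cauchy n (fun i j => pure (ider i a) (ider j b))).

Lemma tens_ider_balanced n : balanced_map
  (fun (a : M) (b : N) => cauchy n (fun i j => pure (ider i a) (ider j b))).
Proof.
split=> [b a a'|a b b'|k a b].
- by rewrite -cauchyD; apply: eq_cauchy => i j _; rewrite iderD pureDl.
- by rewrite -cauchyD; apply: eq_cauchy => i j _; rewrite iderD pureDr.
transitivity (cauchy n (fun m j => cauchy m (fun p i =>
    pure (ider p k *: ider i a) (ider j b)))).
  by apply: eq_cauchy => i j _; rewrite iderZ pure_suml.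
transitivity (cauchy n (fun i m => cauchy m (fun p j =>
    pure (ider i a) (ider p k *: ider j b)))); last first.
  by apply: eq_cauchy => i j _; rewrite iderZ pure_sumr.
rewrite -(cauchyA _ (fun i p j => pure (ider i a) (ider p k *: ider j b))).
apply: eq_cauchy => m j _; rewrite cauchyC.
by apply: eq_cauchy => i p _; rewrite pureZ.
Qed.

Lemma tens_ider_pure n a b :
  tens_ider n (pure a b) = cauchy n (fun i j => pure (ider i a) (ider j b)).
Proof. exact/tens_lift_pure/tens_ider_balanced. Qed.

Fact tens_iderD n : {morph tens_ider n : x y / x + y}.
Proof. exact/tens_liftD/tens_ider_balanced. Qed.

Fact tens_ider0n x : tens_ider 0 x = x.
Proof.
elim/tens_ind: x => [a b|x y IHx IHy]; last by rewrite tens_iderD IHx IHy.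
by rewrite tens_ider_pure /cauchy big_ord1 !ider0n.
Qed.

Lemma tens_ider_sum n (I : Type) (r : seq I) (F : I -> tens M N) :
  tens_ider n (\sum_(i <- r) F i) = \sum_(i <- r) tens_ider n (F i).
Proof.
have tens_ider0 : tens_ider n 0 = 0.
  by apply: (addIr (tens_ider n 0)); rewrite -tens_iderD !add0r.
by rewrite (big_morph (tens_ider n) (tens_iderD n) tens_ider0).
Qed.

Fact tens_ider_comp i j x :
  tens_ider i (tens_ider j x) = tens_ider (i + j) x *+ 'C(i + j, i).
Proof.
elim/tens_ind: x => [a b|x y IHx IHy]; last first.
  by rewrite !tens_iderD IHx IHy mulrnDl.
rewrite !tens_ider_pure -cauchy_bin {1}/cauchy tens_ider_sum.
under eq_bigr do rewrite tens_ider_pure.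
rewrite -(cauchy_sum _ i (fun (p : 'I_j.+1) u v =>
  pure (ider u (ider p a)) (ider v (ider (j - p)%N b)))).
apply: eq_cauchy => u v _; apply: eq_bigr => p _.
by rewrite !ider_comp pureMnl pureMnr -mulrnA mulnC.
Qed.

HB.instance Definition _ :=
  hasIterDer.Build (tens M N) tens_iderD tens_ider0n tens_ider_comp.

Lemma ider_pure n (a : M) (b : N) :
  ider n (pure a b) = cauchy n (fun i j => pure (ider i a) (ider j b)).
Proof. exact: tens_ider_pure. Qed.
End TensorIter.

Section TensorAlgebra.
Variables (K : comNzRingType) (A B : comAlgType K).

Definition tensA := tens A B.
HB.instance Definition _ := GRing.Zmodule.on tensA.

Definition tensA_mul (x y : tensA) : tensA :=
  tens_lift (fun a b => tens_lift (fun a' b' => pure (a * a') (b * b')) y) x.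

Let mul_balanced1 (a : A) (b : B) :
  balanced_map (fun (a' : A) (b' : B) => pure (a * a') (b * b') : tens A B).
Proof.
split=> [b' a' a''|a' b' b''|k a' b'].
- by rewrite mulrDr pureDl.
- by rewrite mulrDr pureDr.
- by rewrite -scalerAr pureZ scalerAr.
Qed.

Let mul_balanced2 (y : tensA) : balanced_map (fun (a : A) (b : B) =>
  tens_lift (fun a' b' => pure (a * a') (b * b')) y : tens A B).
Proof.
split=> [b a a'|a b b'|k a b]; rewrite -?big_split; apply: eq_bigr => p _ /=.
- by rewrite mulrDl pureDl.
- by rewrite mulrDl pureDr.
- by rewrite -!scalerAl pureZ.
Qed.

Lemma tensA_mul_pure a b a' b' :
  tensA_mul (pure a b) (pure a' b') = pure (a * a') (b * b').
Proof.
by rewrite /tensA_mul (tens_lift_pure (mul_balanced2 _))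
           (tens_lift_pure (mul_balanced1 _ _)).
Qed.

Fact tensA_mulDl : left_distributive tensA_mul +%R.
Proof. by move=> x y z; rewrite /tensA_mul (tens_liftD (mul_balanced2 _)). Qed.

Lemma tensA_mulDr : right_distributive tensA_mul +%R.
Proof.
move=> x y z; rewrite /tensA_mul /tens_lift -big_split; apply: eq_bigr => p _ /=.
exact: (tens_liftD (mul_balanced1 _ _)).
Qed.

Fact tensA_mulC : commutative tensA_mul.
Proof.
move=> x y; elim/tens_ind: x => [a b|x x' IHx IHx']; last first.
  by rewrite tensA_mulDl tensA_mulDr IHx IHx'.
elim/tens_ind: y => [a' b'|y y' IHy IHy']; last first.
  by rewrite tensA_mulDl tensA_mulDr IHy IHy'.
by rewrite !tensA_mul_pure mulrC (mulrC b).
Qed.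

Fact tensA_mulA : associative tensA_mul.
Proof.
move=> x y z; elim/tens_ind: x => [a b|x x' IHx IHx']; last first.
  by rewrite !tensA_mulDl IHx IHx'.
elim/tens_ind: y => [a' b'|y y' IHy IHy']; last first.
  by rewrite tensA_mulDr !tensA_mulDl tensA_mulDr IHy IHy'.
elim/tens_ind: z => [a'' b''|z z' IHz IHz']; last first.
  by rewrite !tensA_mulDr IHz IHz'.
by rewrite !tensA_mul_pure !mulrA.
Qed.

Fact tensA_mul1 : left_id (pure 1 1 : tensA) tensA_mul.
Proof.
move=> x; elim/tens_ind: x => [a b|x x' IHx IHx'].
  by rewrite tensA_mul_pure !mul1r.
by rewrite tensA_mulDr IHx IHx'.
Qed.

HB.instance Definition _ := GRing.Zmodule_isComPzRing.Build tensA
  tensA_mulA tensA_mulC tensA_mul1 tensA_mulDl.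

Definition tpure (a : A) (b : B) : tensA := pure a b.

Lemma tpureM a b a' b' : tpure a b * tpure a' b' = tpure (a * a') (b * b').
Proof. exact: tensA_mul_pure. Qed.

Lemma tpure1 : tpure 1 1 = 1.
Proof. by []. Qed.
End TensorAlgebra.

Section TensorIDAlgebra.
Variables (K : idRingType) (A B : idAlgType K).

HB.instance Definition _ := IterZmod.copy (tensA A B) (tens A B).

Fact tensA_ider1 n : ider n (1 : tensA A B) = (n == 0%N)%:R.
Proof.
rewrite [LHS]ider_pure; case: n => [|n].
  by rewrite /cauchy big_ord1 !ider1.
rewrite /cauchy big1 // => i _; rewrite !ider1.
case: (i : nat) => [|k]; last by rewrite pure0l.
by rewrite subn0 pure0r.
Qed.

Fact tensA_iderM n (x y : tensA A B) :
  ider n (x * y) = cauchy n (fun i j => ider i x * ider j y).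
Proof.
elim/tens_ind: x => [a b|x x' IHx IHx']; last first.
  rewrite mulrDl iderD IHx IHx' -cauchyD.
  by apply: eq_cauchy => i j _; rewrite iderD mulrDl.
elim/tens_ind: y => [a' b'|y y' IHy IHy']; last first.
  rewrite mulrDr iderD IHy IHy' -cauchyD.
  by apply: eq_cauchy => i j _; rewrite iderD mulrDr.
rewrite [X in ider n X]tpureM [LHS]ider_pure.
transitivity (cauchy n (fun u v => cauchy u (fun i j => cauchy v (fun k l =>
    tpure (ider i a) (ider k b) * tpure (ider j a') (ider l b'))))).
  apply: eq_cauchy => u v _; rewrite !iderM /cauchy pure_suml.
  apply: eq_bigr => i _; rewrite pure_sumr; apply: eq_bigr => j _.
  by rewrite tpureM.
rewrite (cauchyACA _ (fun i j k l =>
    tpure (ider i a) (ider k b) * tpure (ider j a') (ider l b'))).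
apply: eq_cauchy => u v _; rewrite [X in X * _]ider_pure [X in _ * X]ider_pure.
rewrite /cauchy mulr_suml; apply: eq_bigr => i _.
by rewrite mulr_sumr.
Qed.

HB.instance Definition _ := isIDRing.Build (tensA A B) tensA_ider1 tensA_iderM.

Lemma ider_tpure n (a : A) (b : B) :
  ider n (tpure a b) = cauchy n (fun i j => tpure (ider i a) (ider j b)).
Proof. exact: ider_pure. Qed.
End TensorIDAlgebra.

(* bchange A M is A (x)_K M seen as an A-module, tens carrying no module
   structure of its own. *)
Section BaseChange.
Variables (K : comNzRingType) (A : comAlgType K) (M : lmodType K).

Definition bchange := tens A M.
HB.instance Definition _ := GRing.Zmodule.on bchange.

Definition bscale (a : A) (x : bchange) : bchange :=
  tens_lift (fun b m => pure (a * b) m) x.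

Let bscale_balanced (a : A) :
  balanced_map (fun (b : A) (m : M) => pure (a * b) m : tens A M).
Proof.
split=> [m b b'|b m m'|k b m]; first by rewrite mulrDr pureDl.
- by rewrite pureDr.
- by rewrite -scalerAr pureZ.
Qed.

Lemma bscale_pure a b m : bscale a (pure b m) = pure (a * b) m.
Proof. exact: tens_lift_pure (bscale_balanced _) _ _. Qed.

Fact bscaleDr : right_distributive bscale +%R.
Proof. move=> a; exact: tens_liftD (bscale_balanced a). Qed.

Fact bscaleA a b x : bscale a (bscale b x) = bscale (a * b) x.
Proof.
elim/tens_ind: x => [c m|x y IHx IHy]; last by rewrite !bscaleDr IHx IHy.
by rewrite !bscale_pure mulrA.
Qed.

Fact bscale1 : left_id 1 bscale.
Proof.
elim/tens_ind=> [c m|x y IHx IHy]; last by rewrite bscaleDr IHx IHy.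
by rewrite bscale_pure mul1r.
Qed.

Fact bscaleDl x : {morph bscale^~ x : a b / a + b}.
Proof.
move=> a b; elim/tens_ind: x => [c m|x y IHx IHy]; last first.
  by rewrite !bscaleDr IHx IHy addrACA.
by rewrite !bscale_pure mulrDl pureDl.
Qed.

HB.instance Definition _ := GRing.Zmodule_isLmodule.Build A bchange
  bscaleA bscale1 bscaleDr bscaleDl.

Lemma bchange_scale_pure (a b : A) (m : M) :
  a *: (pure b m : bchange) = pure (a * b) m.
Proof. exact: bscale_pure. Qed.
End BaseChange.

Section BaseChangeID.
Variables (K : idRingType) (A : idAlgType K).

HB.instance Definition _ (M : idLmodType K) :=
  IterZmod.copy (bchange A M) (tens A M).

Fact bchange_iderZ (M : idLmodType K) n (a : A) (x : bchange A M) :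
  ider n (a *: x) = cauchy n (fun i j => ider i a *: ider j x).
Proof.
elim/tens_ind: x => [b m|x y IHx IHy]; last first.
  rewrite scalerDr iderD IHx IHy -cauchyD.
  by apply: eq_cauchy => i j _; rewrite iderD scalerDr.
rewrite bchange_scale_pure [LHS]ider_pure.
transitivity (cauchy n (fun u j => cauchy u (fun i k =>
    ider i a *: (pure (ider k b) (ider j m) : bchange A M)))).
  apply: eq_cauchy => u j _; rewrite iderM pure_suml.
  by apply: eq_bigr => i _; rewrite bchange_scale_pure.
rewrite (cauchyA _ (fun i k j =>
    ider i a *: (pure (ider k b) (ider j m) : bchange A M))).
apply: eq_cauchy => i u _; rewrite [X in _ *: X]ider_pure.
by rewrite /cauchy scaler_sumr.
Qed.

HB.instance Definition _ (M : idLmodType K) :=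
  isIDLmod.Build A (bchange A M) (@bchange_iderZ M).

Fact bchange_fin_gen (M : idModType K) : exists (n : nat) (v : 'I_n -> bchange A M),
  forall m, exists c : 'I_n -> A, m = \sum_i c i *: v i.
Proof.
have [n [v vP]] := @fin_gen _ M.
exists n, (fun i => pure 1 (v i)); elim/tens_ind => [a m|x y [c ->] [d ->]].
  have [c ->] := vP m; exists (fun i => a * (c i)%:A).
  rewrite pure_sumr; apply: eq_bigr => i _.
  by rewrite bchange_scale_pure mulr1 -pureZ mulr_algr.
exists (fun i => c i + d i); rewrite -big_split; apply: eq_bigr => i _.
by rewrite scalerDl.
Qed.

HB.instance Definition _ (M : idModType K) :=
  isFinGen.Build A (bchange A M) (@bchange_fin_gen M).
End BaseChangeID.

Definition is_const (V : iterZmodType) (x : V) : Prop :=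
  forall n, ider n x = if n == 0%N then x else 0.

Definition idconst (V : iterZmodType) : {pred V} := fun x => `[< is_const x >].
Arguments idconst : clear implicits.

Lemma idconstP (V : iterZmodType) (x : V) : reflect (is_const x) (x \in idconst V).
Proof. exact: asboolP. Qed.

Section ConstRing.
Variable R : idPzRingType.

Lemma cauchy0 (V : zmodType) n (G : nat -> nat -> V) :
  (forall i j, (i != 0%N) || (j != 0%N) -> G i j = 0) ->
  cauchy n G = if n == 0%N then G 0%N 0%N else 0.
Proof.
move=> G0; case: n => [|n]; first by rewrite /cauchy big_ord1.
rewrite /cauchy big1 // => i _; apply: G0.
by case: (i : nat) => //; rewrite subn0.
Qed.

Fact idconst_subring : subring_closed (idconst R).
Proof.
split=> [|x y /idconstP cx /idconstP cy|x y /idconstP cx /idconstP cy];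
    apply/idconstP => n.
- by rewrite ider1; case: n.
- by rewrite iderD iderN cx cy; case: n => //=; rewrite subrr.
rewrite iderM cauchy0 ?cx ?cy // => i j; rewrite cx cy.
by case: i j => [|i] [|j] //= _; rewrite ?mul0r ?mulr0.
Qed.

HB.instance Definition _ :=
  GRing.isSubringClosed.Build R (idconst R) idconst_subring.

Record consts := Const { cval : R; cvalP : cval \in idconst R }.
HB.instance Definition _ := [isSub for cval].
HB.instance Definition _ := [Choice of consts by <:].
HB.instance Definition _ :=
  GRing.SubChoice_isSubComPzRing.Build R (idconst R) consts idconst_subring.

Definition consts_ider (n : nat) (x : consts) : consts := if n == 0%N then x else 0.

Fact consts_iderD n : {morph consts_ider n : x y / x + y}.
Proof. by move=> x y; rewrite /consts_ider; case: eqP; rewrite ?addr0. Qed.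

Fact consts_ider0n x : consts_ider 0 x = x. Proof. by []. Qed.

Fact consts_ider_comp i j x :
  consts_ider i (consts_ider j x) = consts_ider (i + j) x *+ 'C(i + j, i).
Proof. by case: i j => [|i] [|j]; rewrite ?mul0rn //= bin0. Qed.

HB.instance Definition _ :=
  hasIterDer.Build consts consts_iderD consts_ider0n consts_ider_comp.

Fact consts_ider1 n : ider n (1 : consts) = (n == 0%N)%:R.
Proof. by case: n. Qed.

Fact consts_iderM n (x y : consts) :
  ider n (x * y) = cauchy n (fun i j => ider i x * ider j y).
Proof.
rewrite cauchy0; first by case: n.
by move=> [|i] [|j] //= _; rewrite ?mul0r ?mulr0.
Qed.

HB.instance Definition _ := isIDRing.Build consts consts_ider1 consts_iderM.
End ConstRing.

Section ConstNz.
Variable R : idRingType.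
Fact consts_oner_neq0 : (1 : consts R) != 0.
Proof. by rewrite -val_eqE /= oner_neq0. Qed.
HB.instance Definition _ :=
  GRing.PzSemiRing_isNonZero.Build (consts R) consts_oner_neq0.
End ConstNz.


Section ConstAlg.
Variables (S : idRingType) (A : idAlgType S).

Fact consts_scale_subproof (c : consts S) (x : consts A) :
  cval c *: (cval x : A) \in idconst A.
Proof.
case: c x => [c /= /idconstP cc] [x /= /idconstP cx]; apply/idconstP => n.
rewrite iderZ cauchy0 ?cc ?cx // => i j; rewrite cc cx.
by case: i j => [|i] [|j] //= _; rewrite ?scale0r ?scaler0.
Qed.

Definition consts_scale (c : consts S) (x : consts A) : consts A :=
  Const (consts_scale_subproof c x).

Fact consts_scaleA a b x :
  consts_scale a (consts_scale b x) = consts_scale (a * b) x.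
Proof. by apply: val_inj; rewrite /= scalerA. Qed.

Fact consts_scale1 : left_id 1 consts_scale.
Proof. by move=> x; apply: val_inj; rewrite /= scale1r. Qed.

Fact consts_scaleDr : right_distributive consts_scale +%R.
Proof. by move=> a x y; apply: val_inj; rewrite /= scalerDr. Qed.

Fact consts_scaleDl x : {morph consts_scale^~ x : a b / a + b}.
Proof. by move=> a b; apply: val_inj; rewrite /= scalerDl. Qed.

HB.instance Definition _ := GRing.Zmodule_isLmodule.Build (consts S) (consts A)
  consts_scaleA consts_scale1 consts_scaleDr consts_scaleDl.

Fact consts_scaleAl (a : consts S) (x y : consts A) : a *: (x * y) = a *: x * y.
Proof. by apply: val_inj; rewrite /= scalerAl. Qed.

HB.instance Definition _ :=
  GRing.Lmodule_isLalgebra.Build (consts S) (consts A) consts_scaleAl.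
HB.instance Definition _ :=
  GRing.Lalgebra_isComAlgebra.Build (consts S) (consts A).
End ConstAlg.


(* An S-algebra seen as an algebra over the constants of S. *)
Section OverConst.
Variables (S : idRingType) (A : idAlgType S).

Definition overC : Type := A.
HB.instance Definition _ := IDRing.copy overC A.

Definition overC_scale (c : consts S) (x : overC) : overC := cval c *: (x : A).

Fact overC_scaleA a b x : overC_scale a (overC_scale b x) = overC_scale (a * b) x.
Proof. exact: scalerA. Qed.

Fact overC_scale1 : left_id 1 overC_scale.
Proof. exact: scale1r. Qed.

Fact overC_scaleDr : right_distributive overC_scale +%R.
Proof. by move=> a x y; exact: scalerDr. Qed.

Fact overC_scaleDl x : {morph overC_scale^~ x : a b / a + b}.
Proof. by move=> a b; exact: scalerDl. Qed.

HB.instance Definition _ := GRing.Zmodule_isLmodule.Build (consts S) overC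
  overC_scaleA overC_scale1 overC_scaleDr overC_scaleDl.

Fact overC_scaleAl (a : consts S) (x y : overC) : a *: (x * y) = a *: x * y.
Proof. exact: scalerAl. Qed.

HB.instance Definition _ :=
  GRing.Lmodule_isLalgebra.Build (consts S) overC overC_scaleAl.
HB.instance Definition _ := GRing.Lalgebra_isComAlgebra.Build (consts S) overC.

Fact overC_iderZ n (a : consts S) (x : overC) :
  ider n (a *: x) = cauchy n (fun i j => ider i a *: ider j x).
Proof.
rewrite [LHS](iderZ n (cval a) (x : A)); apply: eq_cauchy => i j _.
by have /idconstP ca := cvalP a; rewrite ca; case: i.
Qed.

HB.instance Definition _ := isIDLmod.Build (consts S) overC overC_iderZ.
End OverConst.

(* D with the iterative derivation theta(d) = d. *)
Section TrivialID.
Variables (S : idRingType) (D : comAlgType (consts S)).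

Definition trivID : Type := D.
HB.instance Definition _ := GRing.ComAlgebra.copy trivID D.

Definition triv_ider (n : nat) (x : trivID) : trivID := if n == 0%N then x else 0.

Fact triv_iderD n : {morph triv_ider n : x y / x + y}.
Proof. by move=> x y; rewrite /triv_ider; case: eqP; rewrite ?addr0. Qed.

Fact triv_ider0n x : triv_ider 0 x = x. Proof. by []. Qed.

Fact triv_ider_comp i j x :
  triv_ider i (triv_ider j x) = triv_ider (i + j) x *+ 'C(i + j, i).
Proof. by case: i j => [|i] [|j]; rewrite ?mul0rn //= bin0. Qed.

HB.instance Definition _ :=
  hasIterDer.Build trivID triv_iderD triv_ider0n triv_ider_comp.

Fact triv_ider1 n : ider n (1 : trivID) = (n == 0%N)%:R.
Proof. by case: n. Qed.

Fact triv_iderM n (x y : trivID) :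
  ider n (x * y) = cauchy n (fun i j => ider i x * ider j y).
Proof.
rewrite cauchy0; first by case: n.
by move=> [|i] [|j] //= _; rewrite ?mul0r ?mulr0.
Qed.

HB.instance Definition _ := isIDRing.Build trivID triv_ider1 triv_iderM.

Fact triv_iderZ n (a : consts S) (x : trivID) :
  ider n (a *: x) = cauchy n (fun i j => ider i a *: ider j x).
Proof.
rewrite cauchy0; first by case: n.
by move=> [|i] [|j] //= _; rewrite ?scale0r ?scaler0.
Qed.

HB.instance Definition _ := isIDLmod.Build (consts S) trivID triv_iderZ.
End TrivialID.

HB.instance Definition _ (S : idRingType) := IDRing.copy S^o S.
HB.instance Definition _ (S : idRingType) := isIDLmod.Build S S^o (@iderM S).


(* R (x)_S R, with S acting through either factor; it is nonzero because of the
   multiplication map to R. *)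
Section TensorSquare.
Variables (K : idRingType) (A : idAlgType K).

Definition tens_sq := tensA A A.
HB.instance Definition _ := IDPzRing.copy tens_sq (tensA A A).

Fact tens_sq_oner_neq0 : (1 : tens_sq) != 0.
Proof.
have mulB : balanced_map (fun a b : A => a * b).
  split=> [b a a'|a b b'|k a b]; first by rewrite mulrDl.
    by rewrite mulrDr.
  by rewrite -scalerAl scalerAr.
apply/eqP => /(congr1 (tens_lift (fun a b : A => a * b))).
rewrite (tens_lift_pure mulB) -(pure0l A 0) (tens_lift_pure mulB) mulr1 mul0r.
by apply/eqP/oner_neq0.
Qed.

HB.instance Definition _ :=
  GRing.PzSemiRing_isNonZero.Build tens_sq tens_sq_oner_neq0.

Definition tens_sq_scale (k : K) (x : tens_sq) : tens_sq := tpure k%:A 1 * x.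

Fact tens_sq_scaleA a b x :
  tens_sq_scale a (tens_sq_scale b x) = tens_sq_scale (a * b) x.
Proof. by rewrite /tens_sq_scale mulrA tpureM mulr1 mulr_algl scalerA. Qed.

Fact tens_sq_scale1 : left_id 1 tens_sq_scale.
Proof. by move=> x; rewrite /tens_sq_scale scale1r mul1r. Qed.

Fact tens_sq_scaleDr : right_distributive tens_sq_scale +%R.
Proof. by move=> a x y; rewrite /tens_sq_scale mulrDr. Qed.

Fact tens_sq_scaleDl x : {morph tens_sq_scale^~ x : a b / a + b}.
Proof. by move=> a b; rewrite /tens_sq_scale scalerDl -mulrDl /tpure pureDl. Qed.

HB.instance Definition _ := GRing.Zmodule_isLmodule.Build K tens_sq
  tens_sq_scaleA tens_sq_scale1 tens_sq_scaleDr tens_sq_scaleDl.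

Fact tens_sq_scaleAl (a : K) (x y : tens_sq) : a *: (x * y) = a *: x * y.
Proof. exact: mulrA. Qed.

HB.instance Definition _ := GRing.Lmodule_isLalgebra.Build K tens_sq tens_sq_scaleAl.
HB.instance Definition _ := GRing.Lalgebra_isComAlgebra.Build K tens_sq.

Lemma ider_alg (B : idAlgType K) n (k : K) : ider n (k%:A : B) = (ider n k)%:A.
Proof.
rewrite iderZ /cauchy big_ord_recr /= big1 ?add0r ?subnn ?ider0n // => i _.
by rewrite ider1 subn_eq0 leqNgt ltn_ord scaler0.
Qed.

Fact tens_sq_iderZ n (a : K) (x : tens_sq) :
  ider n (a *: x) = cauchy n (fun i j => ider i a *: ider j x).
Proof.
rewrite [LHS](@iderM (tensA A A)); apply: eq_cauchy => i j _; congr (_ * _).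
rewrite ider_tpure /cauchy big_ord_recr /= big1 ?add0r => [|m _].
  by rewrite ider_alg subnn ider0n.
by rewrite ider1 subn_eq0 leqNgt ltn_ord /tpure pure0r.
Qed.

HB.instance Definition _ := isIDLmod.Build K tens_sq tens_sq_iderZ.
End TensorSquare.

Definition idsimple (R : idRingType) : Prop :=
  forall I : R -> Prop,
    I 0 -> (forall x y, I x -> I y -> I (x + y)) -> (forall a x, I x -> I (a * x)) ->
    (forall n x, I x -> I (ider n x)) ->
  (forall x, I x -> x = 0) \/ (forall x, I x).

Definition trivial_idmod (K : idRingType) (M : idModType K) : Prop :=
  exists (n : nat) (e : 'I_n -> M),
    (forall i, is_const (e i)) /\
    (forall m, exists! c : {ffun 'I_n -> K}, m = \sum_i c i *: e i).

Definition commutes_ider (V W : iterZmodType) (g : V -> W) : Prop :=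
  forall n x, g (ider n x) = ider n (g x).

(* The structure map S -> R is s |-> s%:A; the second clause is C_R = f(C_S). *)
Definition solution_ring (S : idRingType) (M : idModType S) (R : idAlgType S) : Prop :=
  [/\ idsimple R,
      forall r : R, is_const r <-> exists2 c : S, is_const c & r = c%:A
    & trivial_idmod (bchange R M)].

Definition PV_ring (S : idRingType) (M : idModType S) (R : idAlgType S) : Prop :=
  solution_ring M R /\
  forall R' : idAlgType S, solution_ring M R' ->
  forall g : {lrmorphism R' -> R}, commutes_ider g -> bijective g.

Definition PV_extension (S : idRingType) (R : idAlgType S) : Prop :=
  exists M : idModType S, PV_ring M R.

Section TensorMap.
Variables (K : idRingType) (A B A' B' : idAlgType K) (g : A -> A') (h : B -> B').

Definition tens_map : tensA A B -> tensA A' B' :=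
  tens_lift (fun a b => tpure (g a) (h b)).

Hypotheses (gD : {morph g : x y / x + y}) (hD : {morph h : x y / x + y}).
Hypotheses (gZ : forall (k : K) a, g (k *: a) = k *: g a).
Hypotheses (hZ : forall (k : K) b, h (k *: b) = k *: h b).

Let map_balanced : balanced_map (fun a b => tpure (g a) (h b)).
Proof.
split=> [b a a'|a b b'|k a b]; first by rewrite gD /tpure pureDl.
  by rewrite hD /tpure pureDr.
by rewrite gZ hZ /tpure pureZ.
Qed.

Lemma tens_map_pure a b : tens_map (tpure a b) = tpure (g a) (h b).
Proof. exact: (tens_lift_pure map_balanced). Qed.

Lemma tens_mapD : {morph tens_map : x y / x + y}.
Proof. exact: tens_liftD map_balanced. Qed.

Lemma tens_mapM :
  (forall a a', g (a * a') = g a * g a') -> (forall b b', h (b * b') = h b * h b') ->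
  {morph tens_map : x y / x * y}.
Proof.
move=> gM hM x y; elim/tens_ind: x => [a b|x x' IHx IHx']; last first.
  by rewrite mulrDl !tens_mapD IHx IHx' mulrDl.
elim/tens_ind: y => [a' b'|y y' IHy IHy']; last first.
  by rewrite mulrDr !tens_mapD IHy IHy' mulrDr.
by rewrite tpureM !tens_map_pure tpureM gM hM.
Qed.

Lemma tens_map_ider :
  commutes_ider g -> commutes_ider h -> commutes_ider tens_map.
Proof.
move=> gi hi n x; elim/tens_ind: x => [a b|x x' IHx IHx']; last first.
  by rewrite iderD !tens_mapD iderD IHx IHx'.
rewrite [X in tens_map X]ider_tpure [X in ider n X]tens_map_pure ider_tpure.
have map0 : tens_map 0 = 0.
  by apply: (addIr (tens_map 0)); rewrite -tens_mapD !add0r.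
rewrite /cauchy (big_morph _ tens_mapD map0); apply: eq_bigr => i _.
by rewrite tens_map_pure gi hi.
Qed.
End TensorMap.

Section IDAut.
Variables (S : idRingType) (R : idAlgType S).
Local Notation C := (consts S).
Implicit Types D E F : comAlgType C.

(* A (x)_C D, for an S-algebra A and a C-algebra D with trivial derivation. *)
Definition scalar_ext (A : idAlgType S) D := tensA (overC A) (trivID D).
HB.instance Definition _ A D :=
  IDPzRing.copy (scalar_ext A D) (tensA (overC A) (trivID D)).

(* The ring homomorphism S (x)_C D -> R (x)_C D through which R (x)_C D is an
   (S (x)_C D)-algebra; S^o is S as an algebra over itself. *)
Definition scalar_ext_str D : scalar_ext S^o D -> scalar_ext R D :=
  @tens_map C (overC S^o) (trivID D) (overC R) (trivID D) (in_alg R) idfun.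

Record idaut D := IDAut {
  idaut_fun :> {rmorphism scalar_ext R D -> scalar_ext R D};
  idaut_bij : bijective idaut_fun;
  idaut_ider : commutes_ider idaut_fun;
  idaut_lin : forall t x,
    idaut_fun (scalar_ext_str t * x) = scalar_ext_str t * idaut_fun x
}.

Lemma idautP D (f g : idaut D) : f =1 g -> f = g.
Proof.
case: f g => [f fb fi fl] [g gb gi gl] /= /funext fg.
have {fg} fg : f = g.
  case: f g fg {fb fi fl gb gi gl} => [f [[fA] [fM]]] [g [[gA] [gM]]] /= fg.
  case: g / fg gA gM => gA gM.
  by rewrite (Prop_irrelevance fA gA) (Prop_irrelevance fM gM).
case: g / fg gb gi gl => gb gi gl.
by rewrite (Prop_irrelevance fb gb) (Prop_irrelevance fi gi) (Prop_irrelevance fl gl).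
Qed.
End IDAut.

Section IDAutGroup.
Variables (S : idRingType) (R : idAlgType S).
Local Notation C := (consts S).
Implicit Types D E F : comAlgType C.

Definition epure D (r : overC R) (d : trivID D) : scalar_ext R D := tpure r d.

Section Group.
Variable D : comAlgType C.
Local Notation T := (scalar_ext R D).
Local Notation str := (@scalar_ext_str S R D).

HB.instance Definition _ := gen_eqMixin (idaut R D).
HB.instance Definition _ := gen_choiceMixin (idaut R D).

Fact idaut_one_ider : commutes_ider (idfun : T -> T). Proof. by []. Qed.
Definition idaut_one : idaut R D :=
  @IDAut S R D idfun (Bijective (fun=> erefl) (fun=> erefl))
    idaut_one_ider (fun _ _ => erefl).

Section Mul.
Variables f g : idaut R D.
Fact idaut_mul_bij : bijective (f \o g).
Proof. exact: bij_comp (idaut_bij f) (idaut_bij g). Qed.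
Fact idaut_mul_ider : commutes_ider (f \o g).
Proof. by move=> n x; rewrite /= !idaut_ider. Qed.
Fact idaut_mul_lin t x : (f \o g) (str t * x) = str t * (f \o g) x.
Proof. by rewrite /= !idaut_lin. Qed.
Definition idaut_mul : idaut R D :=
  IDAut idaut_mul_bij idaut_mul_ider idaut_mul_lin.
End Mul.

Section Inv.
Variable f : idaut R D.

Fact idaut_inv_subproof : {g : T -> T | cancel f g & cancel g f}.
Proof. by apply: cid2; case: (idaut_bij f) => g fK gK; exists g. Qed.

Definition idaut_inv_fun : T -> T := s2val idaut_inv_subproof.

Lemma idaut_funK : cancel f idaut_inv_fun.
Proof. by rewrite /idaut_inv_fun; case: idaut_inv_subproof. Qed.

Lemma idaut_invK : cancel idaut_inv_fun f.
Proof. by rewrite /idaut_inv_fun; case: idaut_inv_subproof. Qed.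

Fact idaut_inv_zmod : zmod_morphism idaut_inv_fun.
Proof. exact: can2_zmod_morphism idaut_funK idaut_invK. Qed.

Fact idaut_inv_monoid : monoid_morphism idaut_inv_fun.
Proof. exact: can2_monoid_morphism idaut_funK idaut_invK. Qed.

HB.instance Definition _ :=
  GRing.isZmodMorphism.Build T T idaut_inv_fun idaut_inv_zmod.
HB.instance Definition _ :=
  GRing.isMonoidMorphism.Build T T idaut_inv_fun idaut_inv_monoid.

Fact idaut_inv_bij : bijective idaut_inv_fun.
Proof. exact: Bijective idaut_invK idaut_funK. Qed.

Fact idaut_inv_ider : commutes_ider idaut_inv_fun.
Proof.
by move=> n x; apply: (can_inj idaut_funK); rewrite idaut_ider !idaut_invK.
Qed.

Fact idaut_inv_lin t x : idaut_inv_fun (str t * x) = str t * idaut_inv_fun x.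
Proof. by apply: (can_inj idaut_funK); rewrite idaut_lin !idaut_invK. Qed.

Definition idaut_inv : idaut R D :=
  IDAut idaut_inv_bij idaut_inv_ider idaut_inv_lin.
End Inv.

Fact idaut_mulA : associative idaut_mul.
Proof. by move=> f g h; apply: idautP. Qed.
Fact idaut_mul1 : left_id idaut_one idaut_mul.
Proof. by move=> f; apply: idautP. Qed.
Fact idaut_mulr1 : right_id idaut_one idaut_mul.
Proof. by move=> f; apply: idautP. Qed.
Fact idaut_mulV : left_inverse idaut_one idaut_inv idaut_mul.
Proof. by move=> f; apply: idautP => x; exact: idaut_funK. Qed.
Fact idaut_mulrV : right_inverse idaut_one idaut_inv idaut_mul.
Proof. by move=> f; apply: idautP => x; exact: idaut_invK. Qed.

HB.instance Definition _ := isGroup.Build (idaut R D)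
  idaut_mulA idaut_mul1 idaut_mulr1 idaut_mulV idaut_mulrV.

Lemma epureM r r' d d' :
  epure r d * epure r' d' = epure (r * r') (d * d') :> T.
Proof. exact: tpureM. Qed.

Lemma epure_split r d : epure r d = epure 1 d * epure r 1 :> T.
Proof. by rewrite epureM mul1r mulr1. Qed.

Lemma epure_str (s : S) d : epure s%:A d = str (tpure (s : overC S^o) d).
Proof.
rewrite /scalar_ext_str tens_map_pure //.
- exact: (@scalerDl S R 1).
- by move=> k a; exact: (esym (scalerA (cval k) (a : S) (1 : R))).
Qed.

Lemma idaut_scal (f : idaut R D) (s : S) d x :
  f (epure s%:A d * x) = epure s%:A d * f x.
Proof. by rewrite epure_str idaut_lin. Qed.

Lemma idaut_const (f : idaut R D) d x : f (epure 1 d * x) = epure 1 d * f x.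
Proof. by have := idaut_scal f 1 d x; rewrite scale1r. Qed.

End Group.

Section Map.
Variables (D E : comAlgType C) (u : {lrmorphism D -> E}).

Definition ext_map : scalar_ext R D -> scalar_ext R E :=
  @tens_map C (overC R) (trivID D) (overC R) (trivID E) idfun u.

Lemma ext_map_pure r d : ext_map (epure r d) = epure r (u d : trivID E).
Proof.
apply: tens_map_pure => //; first exact: (raddfD u).
by move=> k b; exact: (linearZZ u).
Qed.

Lemma ext_mapD : {morph ext_map : x y / x + y}.
Proof.
apply: tens_mapD => //; first exact: (raddfD u).
by move=> k b; exact: (linearZZ u).
Qed.

Lemma ext_mapM : {morph ext_map : x y / x * y}.
Proof.
apply: tens_mapM => //; first exact: (raddfD u).
  by move=> k b; exact: (linearZZ u).
exact: (rmorphM u).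
Qed.

Lemma ext_map_ider : commutes_ider ext_map.
Proof.
apply: tens_map_ider => //; first exact: (raddfD u).
  by move=> k b; exact: (linearZZ u).
by move=> [|n] b //; exact: (raddf0 u).
Qed.

(* The extension of f along u : D -> E, i.e. the E-linear endomorphism of
   R (x)_C E = (R (x)_C D) (x)_D E determined by f. *)
Definition idaut_map_fun (f : scalar_ext R D -> scalar_ext R D) :
    scalar_ext R E -> scalar_ext R E :=
  tens_lift (fun (r : overC R) (e : trivID E) =>
    ext_map (f (epure r 1)) * epure 1 e).

Section OneMap.
Variable f : idaut R D.
Local Notation F := (idaut_map_fun f).

Let map_balanced : balanced_map (fun (r : overC R) (e : trivID E) =>
    ext_map (f (epure r 1)) * epure 1 e).
Proof.
split=> [e r r'|r e e'|k r e].
- by rewrite /epure /tpure pureDl rmorphD ext_mapD mulrDl.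
- by rewrite /epure /tpure pureDr mulrDr.
have -> : epure (k *: r) 1 = epure (cval k)%:A 1 * epure r 1 :> scalar_ext R D.
  by rewrite epureM mulr1 [_%:A * _]mulr_algl.
rewrite idaut_scal ext_mapM ext_map_pure mulrAC mulrC; congr (_ * _).
rewrite (_ : (u 1 : trivID E) = 1); last exact: (rmorph1 u).
rewrite epureM mul1r mulr1 /epure.
by rewrite -[RHS]pureZ.
Qed.

Lemma idaut_map_pure r e : F (epure r e) = ext_map (f (epure r 1)) * epure 1 e.
Proof. exact: (tens_lift_pure map_balanced). Qed.

Lemma idaut_mapD : {morph F : x y / x + y}.
Proof. exact: tens_liftD map_balanced. Qed.

Lemma idaut_map1 : F 1 = 1.
Proof.
rewrite [X in F X](_ : _ = epure 1 1) // idaut_map_pure.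
rewrite [epure 1 1 in X in X * _](_ : _ = 1) // rmorph1 mulr1.
rewrite [X in ext_map X](_ : _ = epure 1 1) // ext_map_pure.
by rewrite (_ : (u 1 : trivID E) = 1) //; exact: (rmorph1 u).
Qed.

Lemma idaut_mapM : {morph F : x y / x * y}.
Proof.
move=> x y; elim/tens_ind: x => [a b|x x' IHx IHx']; last first.
  by rewrite mulrDl !idaut_mapD IHx IHx' mulrDl.
elim/tens_ind: y => [a' b'|y y' IHy IHy']; last first.
  by rewrite mulrDr !idaut_mapD IHy IHy' mulrDr.
rewrite -![pure _ _]/(epure _ _) epureM !idaut_map_pure mulrACA -ext_mapM -rmorphM.
by rewrite !epureM !mulr1.
Qed.

Lemma idaut_map_ext x : F (ext_map x) = ext_map (f x).
Proof.
elim/tens_ind: x => [r d|x y IHx IHy]; last first.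
  by rewrite ext_mapD idaut_mapD rmorphD ext_mapD IHx IHy.
rewrite -[pure _ _]/(epure _ _) ext_map_pure idaut_map_pure.
by rewrite [epure r d]epure_split idaut_const ext_mapM ext_map_pure mulrC.
Qed.

Lemma idaut_map_const e x : F (epure 1 e * x) = epure 1 e * F x.
Proof.
rewrite idaut_mapM idaut_map_pure; congr (_ * _).
rewrite [epure 1 1 in LHS](_ : _ = 1) // rmorph1.
rewrite [X in ext_map X](_ : _ = epure 1 1) // ext_map_pure.
rewrite (_ : (u 1 : trivID E) = 1); last exact: (rmorph1 u).
by rewrite [epure 1 1](_ : _ = 1) // mul1r.
Qed.

Lemma epure1_ider n (x : scalar_ext R E) e :
  ider n (x * epure 1 e) = ider n x * epure 1 e.
Proof.
have ide m : ider m (epure 1 e : scalar_ext R E) = if m == 0%N then epure 1 e else 0.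
  rewrite [LHS]ider_tpure cauchy0; first by case: m; rewrite //= ider0n.
  by move=> [|i] [|j] //= _; rewrite ?ider1 ?pure0l /tpure ?pure0r ?pure0l.
rewrite iderM /cauchy big_ord_recr /= big1 ?add0r ?subnn ?ide // => i _.
by rewrite ide subn_eq0 leqNgt ltn_ord mulr0.
Qed.

Lemma idaut_map_ider : commutes_ider F.
Proof.
move=> n x; elim/tens_ind: x => [r e|x y IHx IHy]; last first.
  by rewrite iderD !idaut_mapD iderD IHx IHy.
rewrite -[pure _ _]/(epure _ _) (idaut_map_pure r) epure1_ider -ext_map_ider -idaut_ider.
have -> : epure r e = epure r 1 * epure 1 e :> scalar_ext R E.
  by rewrite epureM mulr1 mul1r.
rewrite epure1_ider mulrC idaut_map_const mulrC; congr (_ * _).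
have ext1 (z : overC R) : epure z 1 = ext_map (epure z 1) :> scalar_ext R E.
  by rewrite ext_map_pure (_ : (u 1 : trivID E) = 1) //; exact: (rmorph1 u).
by rewrite ext1 -ext_map_ider idaut_map_ext.
Qed.

Lemma idaut_map_lin t x :
  F (scalar_ext_str R t * x) = scalar_ext_str R t * F x.
Proof.
elim/tens_ind: t => [s e|t t' IHt IHt']; last first.
  have strD : {morph @scalar_ext_str S R E : x y / x + y}.
    apply: tens_mapD => //; first exact: (@scalerDl S R 1).
    by move=> k a; exact: (esym (scalerA (cval k) (a : S) (1 : R))).
  by rewrite strD !mulrDl idaut_mapD IHt IHt'.
rewrite -[pure s e]/(tpure (s : overC S^o) e) -epure_str epure_split.
rewrite -!mulrA idaut_map_const; congr (_ * _).
rewrite idaut_mapM; congr (_ * _).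
have ext1 (z : overC R) : epure z 1 = ext_map (epure z 1) :> scalar_ext R E.
  by rewrite ext_map_pure (_ : (u 1 : trivID E) = 1) //; exact: (rmorph1 u).
rewrite !ext1 idaut_map_ext.
by rewrite -[epure _ 1]mulr1 idaut_scal rmorph1.
Qed.
End OneMap.

Lemma idaut_map_fun_comp (f g : idaut R D) :
  idaut_map_fun (idaut_mul f g) =1 idaut_map_fun f \o idaut_map_fun g.
Proof.
move=> x; elim/tens_ind: x => [r e|x y IHx IHy]; last first.
  by rewrite (idaut_mapD (idaut_mul f g)) IHx IHy /= !idaut_mapD.
rewrite -[pure _ _]/(epure _ _) (idaut_map_pure (idaut_mul f g)) /= idaut_map_pure.
by rewrite [in RHS]mulrC idaut_map_const idaut_map_ext mulrC.
Qed.

Lemma idaut_map_fun_one : idaut_map_fun (idaut_one D) =1 id.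
Proof.
move=> x; elim/tens_ind: x => [r e|x y IHx IHy]; last first.
  by rewrite (idaut_mapD (idaut_one D)) IHx IHy.
rewrite -[pure _ _]/(epure _ _) (idaut_map_pure (idaut_one D)) /= ext_map_pure.
rewrite (_ : (u 1 : trivID E) = 1); last exact: (rmorph1 u).
by rewrite epureM mulr1 mul1r.
Qed.

Section MapAut.
Variable f : idaut R D.
Local Notation F := (idaut_map_fun f).

Fact idaut_map_zmod : zmod_morphism F.
Proof.
have F0 : F 0 = 0 by apply: (addIr (F 0)); rewrite -idaut_mapD !add0r.
move=> x y; rewrite idaut_mapD; congr (_ + _).
by apply: (addrI (F y)); rewrite -idaut_mapD !subrr.
Qed.

Fact idaut_map_monoid : monoid_morphism F.
Proof. by split; [exact: idaut_map1 | exact: idaut_mapM]. Qed.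

HB.instance Definition _ := GRing.isZmodMorphism.Build _ _ F idaut_map_zmod.
HB.instance Definition _ := GRing.isMonoidMorphism.Build _ _ F idaut_map_monoid.

Fact idaut_map_bij : bijective F.
Proof.
exists (idaut_map_fun (idaut_inv f)) => x.
  rewrite -[LHS](idaut_map_fun_comp (idaut_inv f) f x).
  by rewrite idaut_mulV idaut_map_fun_one.
rewrite -[LHS](idaut_map_fun_comp f (idaut_inv f) x).
by rewrite idaut_mulrV idaut_map_fun_one.
Qed.

Definition idaut_map : idaut R E :=
  IDAut idaut_map_bij (idaut_map_ider f) (idaut_map_lin f).
End MapAut.

Fact idaut_mapMg (f g : idaut R D) :
  idaut_map (f * g)%g = (idaut_map f * idaut_map g)%g.
Proof. by apply: idautP => x; exact: idaut_map_fun_comp. Qed.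
End Map.

Fact idaut_map_id D (f : idaut R D) : idaut_map (idfun : {lrmorphism D -> D}) f = f.
Proof.
apply: idautP => x /=; elim/tens_ind: x => [r d|x y IHx IHy]; last first.
  by rewrite idaut_mapD rmorphD IHx IHy.
have ext_id y : ext_map (idfun : {lrmorphism D -> D}) y = y.
  elim/tens_ind: y => [a b|y z IHy IHz]; last by rewrite ext_mapD IHy IHz.
  exact: (ext_map_pure (idfun : {lrmorphism D -> D}) a b).
rewrite -[pure _ _]/(epure _ _) idaut_map_pure ext_id.
by rewrite [epure r d]epure_split idaut_const mulrC.
Qed.

Fact idaut_map_comp D E F (u : {lrmorphism D -> E}) (v : {lrmorphism E -> F})
    (f : idaut R D) : idaut_map (v \o u) f = idaut_map v (idaut_map u f).
Proof.
apply: idautP => x.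
rewrite -[LHS]/(idaut_map_fun (v \o u) f x).
rewrite -[RHS]/(idaut_map_fun v (idaut_map u f) x).
elim/tens_ind: x => [r d|x y IHx IHy]; last first.
  by rewrite (idaut_mapD _ f) (idaut_mapD _ (idaut_map u f)) IHx IHy.
have ext_comp y : ext_map (v \o u) y = ext_map v (ext_map u y).
  elim/tens_ind: y => [a b|y z IHy IHz]; last by rewrite !ext_mapD IHy IHz.
  by rewrite -[pure _ _]/(epure _ _) !ext_map_pure.
rewrite -[pure _ _]/(epure _ _) (idaut_map_pure _ f).
rewrite (idaut_map_pure _ (idaut_map u f)); congr (_ * _).
rewrite ext_comp; congr (ext_map v _); rewrite [RHS]idaut_map_pure.
by rewrite [epure 1 1 in RHS](_ : _ = 1) // mulr1.
Qed.
End IDAutGroup.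

(* Covariant functors from nonzero commutative C-algebras to groups. *)
Record groupFunctor (C : comNzRingType) := GroupFunctor {
  gf_obj :> comAlgType C -> groupType;
  gf_map : forall D E : comAlgType C, {lrmorphism D -> E} -> gf_obj D -> gf_obj E;
  gf_mapM : forall (D E : comAlgType C) (u : {lrmorphism D -> E}),
    {morph gf_map u : x y / (x * y)%g};
  gf_map_id : forall (D : comAlgType C) (x : gf_obj D),
    gf_map (idfun : {lrmorphism D -> D}) x = x;
  gf_map_comp : forall (D E F : comAlgType C) (u : {lrmorphism D -> E})
    (v : {lrmorphism E -> F}) (x : gf_obj D),
    gf_map (v \o u) x = gf_map v (gf_map u x)
}.

Definition AutID (S : idRingType) (R : idAlgType S) : groupFunctor (consts S) :=
  GroupFunctor (@idaut_mapMg S R) (@idaut_map_id S R) (@idaut_map_comp S R).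

(* Spec A, as the functor D |-> Hom_C(A, D), is isomorphic to the underlying
   set-valued functor of G. *)
Definition represents (C : comNzRingType) (A : comAlgType C) (G : groupFunctor C) :=
  exists Phi : forall D : comAlgType C, {lrmorphism A -> D} -> G D,
    (forall D, bijective (Phi D)) /\
    (forall (D E : comAlgType C) (u : {lrmorphism D -> E}) (x : {lrmorphism A -> D}),
      Phi E (u \o x) = gf_map u (Phi D x)).

Definition gf_iso (C : comNzRingType) (F G : groupFunctor C) :=
  exists Phi : forall D : comAlgType C, F D -> G D,
    [/\ forall D, bijective (Phi D),
        forall D, {morph Phi D : x y / (x * y)%g}
      & forall (D E : comAlgType C) (u : {lrmorphism D -> E}) (x : F D),
          Phi E (gf_map u x) = gf_map u (Phi D x)].

(* An affine group scheme over C with coordinate ring A: a group structure on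
   the functor of points of Spec A. *)
Record affGroupScheme (C : comNzRingType) (A : comAlgType C) := AffGroupScheme {
  gs_mul : forall D : comAlgType C,
    {lrmorphism A -> D} -> {lrmorphism A -> D} -> {lrmorphism A -> D};
  gs_one : forall D : comAlgType C, {lrmorphism A -> D};
  gs_inv : forall D : comAlgType C, {lrmorphism A -> D} -> {lrmorphism A -> D};
  gs_mulA : forall D, associative (@gs_mul D);
  gs_mul1 : forall D, left_id (@gs_one D) (@gs_mul D);
  gs_mulr1 : forall D, right_id (@gs_one D) (@gs_mul D);
  gs_mulV : forall D, left_inverse (@gs_one D) (@gs_inv D) (@gs_mul D);
  gs_mulrV : forall D, right_inverse (@gs_one D) (@gs_inv D) (@gs_mul D);
  gs_mul_nat : forall (D E : comAlgType C) (u : {lrmorphism D -> E})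
      (x y : {lrmorphism A -> D}),
    u \o gs_mul x y = gs_mul (u \o x) (u \o y) :> {lrmorphism A -> E}
}.

Lemma lrmorphismP (C : comNzRingType) (A B : comAlgType C)
  (f g : {lrmorphism A -> B}) : f =1 g -> f = g.
Proof.
case: f g => [f cf] [g cg] /= /funext fg; case: g / fg cg => cg.
congr GRing.LRMorphism.Pack.
case: cf cg => [[fA] [fM] [fZ]] [[gA] [gM] [gZ]].
by rewrite (Prop_irrelevance fA gA) (Prop_irrelevance fM gM) (Prop_irrelevance fZ gZ).
Qed.

Section Points.
Variables (C : comNzRingType) (A : comAlgType C) (G : affGroupScheme A).
Implicit Types D E F : comAlgType C.

Definition points (_ : affGroupScheme A) D := {lrmorphism A -> D}.
HB.instance Definition _ D := gen_eqMixin (points G D).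
HB.instance Definition _ D := gen_choiceMixin (points G D).
HB.instance Definition _ D := isGroup.Build (points G D) (@gs_mulA C A G D)
  (@gs_mul1 C A G D) (@gs_mulr1 C A G D) (@gs_mulV C A G D) (@gs_mulrV C A G D).

Definition points_map D E (u : {lrmorphism D -> E}) (x : points G D) : points G E :=
  (u : {lrmorphism D -> E}) \o (x : {lrmorphism A -> D}).

Fact points_mapM D E (u : {lrmorphism D -> E}) :
  {morph points_map u : x y / (x * y)%g}.
Proof. by move=> x y; exact: gs_mul_nat. Qed.

Fact points_map_id D (x : points G D) :
  points_map (idfun : {lrmorphism D -> D}) x = x.
Proof. exact: lrmorphismP. Qed.

Fact points_map_comp D E F (u : {lrmorphism D -> E}) (v : {lrmorphism E -> F})
  (x : points G D) : points_map (v \o u) x = points_map v (points_map u x).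
Proof. exact: lrmorphismP. Qed.

Definition points_functor : groupFunctor C :=
  GroupFunctor points_mapM points_map_id points_map_comp.
End Points.

Definition finite_type (C : comNzRingType) (A : comAlgType C) : Prop :=
  exists s : seq A, forall B : {pred A},
    GRing.subalg_closed B -> {subset s <= B} -> forall x, x \in B.

(* Main.v *)
Require Import Defs.
From HB Require Import structures.
From mathcomp Require Import all_boot all_order all_algebra.
From mathcomp Require Import boolp.
From mathcomp Require classical_sets.

(* Write R' for the S-subalgebra of R generated by the coordinates x of M on a
   constant basis of R (x)_S M, by the values y of linear forms on that basis,
   and by their derivatives. Comparing the bases coming from the two factors of
   R (x)_S R gives constants g = sum x (x) y and h = sum y (x) x with
   1 (x) R' inside (R' (x) 1).C[g, h] and R' (x) 1 inside (1 (x) R').C[g, h].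
   Over the ID-simple ring R, an ID-submodule of a trivial module is spanned by
   its constants. Hence, for an ID-ideal J <> 0 of R', the ID-submodule
   R (x) J of R (x)_S R contains 1; since S is a domain this forces J to meet S,
   so J = R'. Thus R' is a solution ring, R' = R by minimality, and
   R (x)_S R = R (x)_C A with A = C_{R (x)_S R} = C[g, h].
   An element of Aut(R/S)(D) is determined by its restriction R -> R (x)_C D,
   i.e. by an R-linear ID-homomorphism R (x)_C A -> R (x)_C D, i.e. by a
   C-algebra homomorphism A -> D, as the constants of R (x)_C D are D. *)

Set Implicit Arguments.
Unset Strict Implicit.
Unset Printing Implicit Defensive.

Import GRing.Theory.
Local Open Scope ring_scope.

(** * ID-simple rings *)

(** [M] is only finitely generated, so there is no square fundamental matrix to invert: [M] is first
    shown to be projective, and a dual basis [f], [v] supplies the forms whose values y replace one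
    of the two inverse matrices. No flatness of R over [S] is used: R (x) J is taken as a span
    inside R (x)_S R, and an equality of tensors is brought back to R' by clearing denominators,
    which is where [S] being a domain enters. Why that span contains 1: for j <> 0 in J, the element
    1 (x) j is a combination of constants of the span with coefficients in R' (x) 1. Moving these
    coefficients to the other factor turns it into a (1 (x) R)-combination of constants of the span.
    So the constant 1, multiplied by the nonzero scalar j, is such a combination; linear relations
    between constants over an ID-simple ring come from relations with constant coefficients, hence 1
    is itself one of these constants. *)

Section IDSimple.
Variables (R : idRingType).
Hypothesis simpleR : idsimple R.

Lemma idsimple_ideal1 (I : R -> Prop) (x : R) :
  I 0 -> (forall x y, I x -> I y -> I (x + y)) -> (forall a x, I x -> I (a * x)) ->
  (forall n x, I x -> I (ider n x)) -> x != 0 -> I x -> I 1.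
Proof.
move=> I0 ID IM Iid nz_x Ix.
by case: (simpleR I0 ID IM Iid) => [I_eq0|//]; rewrite (I_eq0 x) ?eqxx in nz_x.
Qed.

Lemma exists_maximal_ideal : exists P : R -> Prop,
  [/\ ~ P 1, forall x y, P x -> P y -> P (x + y), forall a x, P x -> P (a * x)
    & forall x, ~ P x -> exists a, P (1 - a * x)].
Proof.
pose T := fun P : R -> Prop => [/\ ~ P 1,
  forall x y, P x -> P y -> P (x + y) & forall a x, P x -> P (a * x)].
have [|P [[P1 PD PM] Pmax]] := @classical_sets.Zorn_bigcup R T.
  move=> F FT Ftot; split=> [[A FA A1]|x y [A FA Ax] [B FB By]|a x [A FA Ax]].
  - by have [] := FT _ FA.
  - have [AB|BA] := Ftot _ _ FA FB.
      by exists B => //; have [_ BD _] := FT _ FB; apply: BD => //; apply: AB.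
    by exists A => //; have [_ AD _] := FT _ FA; apply: AD => //; apply: BA.
  - by exists A => //; have [_ _ AM] := FT _ FA; apply: AM.
exists P; split=> // x nPx.
(* The empty predicate satisfies [T], as the union of the empty chain must; so [P 0] has to be drawn
   from maximality, by comparison with the zero ideal. *)
have P0 : P 0.
  apply: contrapT => nP0; apply: (Pmax (fun y => y = 0)).
    split=> [y /= Py|/(_ 0 erefl)//]; case: nP0.
    by rewrite -(mul0r y); apply: PM.
  split=> [/eqP|a b -> ->|a b ->]; first by rewrite oner_eq0.
    by rewrite /= addr0.
  by rewrite /= mulr0.
apply: contrapT => nP; apply: (Pmax (fun y => exists a, P (y - a * x))).
  split=> [y Py|/(_ x) Px]; first by exists 0; rewrite mul0r subr0.
  by apply/nPx/Px; exists 1; rewrite mul1r subrr.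
split=> [//|y z [a Pa] [b Pb]|b y [a Pa]].
  by exists (a + b); rewrite mulrDl opprD addrACA; apply: PD.
by exists (b * a); rewrite -mulrA -mulrBr; apply: PM.
Qed.

(* The elements all of whose derivatives lie in a maximal ideal P form a proper
   ID-ideal, hence 0; so a nonzero element has a derivative outside P, and the
   lowest such derivatives of a and b give one of a * b. *)
Lemma idsimple_domain (a b : R) : a * b = 0 -> a = 0 \/ b = 0.
Proof.
have [P [P1 PD PM Pmax]] := exists_maximal_ideal.
have P0 : P 0.
  by apply: contrapT => /Pmax[c]; rewrite mulr0 subr0.
have Pprime x y : P (x * y) -> P x \/ P y.
  move=> Pxy; case: (pselect (P x)) => [|/Pmax[c Pc]]; [by left|right].
  rewrite -[y]mul1r -[1](subrK (c * x)) mulrDl; apply: PD.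
    by rewrite mulrC; apply: PM.
  by rewrite -mulrA; apply: PM.
have lowest x : x <> 0 -> exists2 n, ~ P (ider n x) &
    forall i, (i < n)%N -> P (ider i x).
  move=> nz_x; have [n nPn] : exists n, ~ P (ider n x).
    apply: contrapT => allP; case: P1; rewrite -[1](ider0n).
    apply: (@idsimple_ideal1 (fun y => forall n, P (ider n y)) x).
    - by move=> n; rewrite ider_0.
    - by move=> y z Py Pz n; rewrite iderD; apply: PD.
    - move=> c y Py n; rewrite iderM /cauchy; elim/big_ind: _ => // i _.
      exact: PM.
    - move=> n y Py i; rewrite ider_comp -mulr_natl; exact: PM.
    - exact/eqP.
    - by move=> n; apply: contrapT => nP; apply: allP; exists n.
  have exn : exists n, ~~ `[< P (ider n x) >] by exists n; apply/asboolPn.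
  case: (ex_minnP exn) => m /asboolPn nPm min_m; exists m => // i im.
  by apply: contrapT => /asboolPn/min_m; rewrite leqNgt im.
move=> ab0; case: (pselect (a = 0)) => [|/lowest[m nPm ltm]]; [by left|].
case: (pselect (b = 0)) => [|/lowest[n nPn ltn]]; [by right|].
have : P (ider m a * ider n b).
  have: ider (m + n) (a * b) = 0 by rewrite ab0 ider_0.
  rewrite iderM /cauchy.
  have mlt : (m < (m + n).+1)%N by rewrite ltnS leq_addr.
  rewrite (bigD1 (Ordinal mlt)) //= addKn => /eqP; rewrite addr_eq0 => /eqP->.
  rewrite -mulN1r; apply: (PM).
  elim/big_ind: _ => // i; rewrite -val_eqE /= => nim.
  case: (ltnP i m) => [im|mi]; first by rewrite mulrC; apply/PM/ltm.
  apply/PM/ltn; have lim : (i <= m + n)%N by rewrite -ltnS.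
  have {mi nim} : (m < i)%N by rewrite ltn_neqAle eq_sym nim.
  by move=> mi; rewrite ltn_subLR // ltn_add2r.
by case/Pprime.
Qed.

(** Multiplication by [c] commutes with theta, so the multiples of [c] form an ID-ideal. The inverse
    [d] is constant because its higher derivatives are killed by [c] in a domain. *)
Lemma idsimple_const_inv (c : R) : is_const c -> c != 0 ->
  exists2 d, is_const d & d * c = 1.
Proof.
move=> cc nz_c.
have iderMc n x : ider n (x * c) = ider n x * c.
  rewrite iderM /cauchy big_ord_recr /= subnn ider0n big1 ?add0r // => i _.
  by rewrite cc subn_eq0 leqNgt ltn_ord mulr0.
have [d dc1] : exists d, 1 = d * c.
  apply: (@idsimple_ideal1 (fun x => exists d, x = d * c) c) => //.
  - by exists 0; rewrite mul0r.
  - by move=> x y [d ->] [e ->]; exists (d + e); rewrite mulrDl.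
  - by move=> a x [d ->]; exists (a * d); rewrite mulrA.
  - by move=> n x [d ->]; exists (ider n d).
  - by exists 1; rewrite mul1r.
exists d => // n; case: n => [|n]; first by rewrite ider0n.
have := iderMc n.+1 d; rewrite -dc1 ider1 => /esym/idsimple_domain[//|c0].
by rewrite c0 eqxx in nz_c.
Qed.


(** The kernel of the structure map is an ID-ideal, and it is proper since [A] is nonzero. *)
Lemma alg_eq0 (A : idAlgType R) (c : R) : c%:A = 0 :> A -> c = 0.
Proof.
move=> cA0; apply: contrapT => /eqP nz_c.
have : (1 : R)%:A = 0 :> A.
  apply: (@idsimple_ideal1 (fun c => c%:A = 0 :> A) c) => //.
  - exact: scale0r.
  - by move=> x y x0 y0; rewrite scalerDl x0 y0 addr0.
  - by move=> a x x0; rewrite -scalerA x0 scaler0.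
  - by move=> n x x0; rewrite -ider_alg x0 ider_0.
by rewrite scale1r => /eqP; rewrite oner_eq0.
Qed.

End IDSimple.

(** * Equalities in tensor products over a domain *)

Section SpanDomain.
Variables (K : comNzRingType).
Hypothesis domK : forall a b : K, a * b = 0 -> a = 0 \/ b = 0.

Lemma domain_mul_neq0 (a b : K) : a != 0 -> b != 0 -> a * b != 0.
Proof.
by move=> nz_a nz_b; apply/eqP => /domK[] /eqP; rewrite ?(negPf nz_a, negPf nz_b).
Qed.

Definition in_span (V : lmodType K) r (v : 'I_r -> V) (x : V) : Prop :=
  exists c : 'I_r -> K, x = \sum_i c i *: v i.

Section InSpan.
Variables (V : lmodType K) (r : nat) (v : 'I_r -> V).

Lemma in_spanD x y : in_span v x -> in_span v y -> in_span v (x + y).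
Proof.
move=> [c ->] [d ->]; exists (fun i => c i + d i).
by rewrite -big_split; apply: eq_bigr => i _; rewrite scalerDl.
Qed.

Lemma in_spanZ a x : in_span v x -> in_span v (a *: x).
Proof.
move=> [c ->]; exists (fun i => a * c i).
by rewrite scaler_sumr; apply: eq_bigr => i _; rewrite scalerA.
Qed.
End InSpan.

(** Greedy choice: [x] joins the family unless a nonzero multiple [a *: x] is already in the span,
    in which case [a] enters the common denominator [d]. The domain hypothesis keeps [d] nonzero. *)
Lemma maximal_indep (V : lmodType K) (s : seq V) :
  exists r (v : 'I_r -> V) (d : K),
    [/\ d != 0,
        forall c : 'I_r -> K, \sum_i c i *: v i = 0 -> forall i, c i = 0
      & forall x, x \in s -> in_span v (d *: x)].
Proof.
elim: s => [|x s [r [v [d [nz_d indep spn]]]]].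
  by exists 0%N, (fun=> 0), 1; split; [exact: oner_neq0 | move=> c _ [] | ].
case: (pselect (exists2 a, a != 0 & in_span v (a *: x))) => [[a nz_a ax]|nx].
  exists r, v, (a * d); split=> // [|y]; first exact: domain_mul_neq0.
  rewrite inE => /predU1P[->|/spn dy]; last by rewrite -scalerA; exact: in_spanZ.
  by rewrite mulrC -scalerA; exact: in_spanZ.
exists r.+1, (fun i => oapp v x (unlift ord0 i)), d; split=> // [c|y].
  rewrite big_ord_recl unlift_none /= => c0.
  have cx0 : c ord0 = 0.
    apply: contrapT => /eqP nz_c; apply: nx; exists (c ord0) => //.
    exists (fun i => - c (lift ord0 i)); move/eqP: c0; rewrite addr_eq0 => /eqP->.
    by rewrite -sumrN; apply: eq_bigr => i _; rewrite liftK scaleNr.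
  move=> i; case: (unliftP ord0 i) => [j|] -> //.
  apply: (indep (fun j => c (lift ord0 j))).
  rewrite -[RHS]c0 cx0 scale0r add0r.
  by apply: eq_bigr => k _; rewrite liftK.
rewrite inE => /predU1P[->|/spn [c dy]].
  exists (fun i => if i == ord0 then d else 0); rewrite big_ord_recl unlift_none eqxx.
  by rewrite big1 ?addr0 // => i _; rewrite scale0r.
exists (fun i => oapp c 0 (unlift ord0 i)); rewrite big_ord_recl unlift_none /=.
by rewrite scale0r add0r dy; apply: eq_bigr => k _; rewrite liftK.
Qed.

(* An equality in M (x) N is witnessed by finitely many elements of M, so
   functionals need only be linear on a finitely generated submodule. *)
Lemma tens_rel_fin (M N : lmodType K) (s t : seq (M * N)) : tens_rel s t ->
  exists G : seq M, forall (L : M -> Prop) (f : M -> K),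
    {in G, forall x, L x} ->
    L 0 -> (forall x y, L x -> L y -> L (x + y)) -> (forall a x, L x -> L (a *: x)) ->
    (forall x y, L x -> L y -> f (x + y) = f x + f y) ->
    (forall a x, L x -> f (a *: x) = a * f x) ->
  \sum_(p <- s) f p.1 *: p.2 = \sum_(p <- t) f p.1 *: p.2.
Proof.
elim=> {s t}.
- by move=> s; exists [::].
- by move=> s t _ [G IH]; exists G => L *; apply/esym/(IH L).
- move=> s t u _ [G IHG] _ [H IHH]; exists (G ++ H) => L f GH *.
  rewrite (IHG L) // => [|x xG]; last by apply: GH; rewrite mem_cat xG.
  by rewrite (IHH L) // => x xH; apply: GH; rewrite mem_cat xH orbT.
- move=> s s' t t' _ [G IHG] _ [H IHH]; exists (G ++ H) => L f GH *.
  rewrite !big_cat; congr (_ + _).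
    by apply: (IHG L) => // x xG; apply: GH; rewrite mem_cat xG.
  by apply: (IHH L) => // x xG; apply: GH; rewrite mem_cat xG orbT.
- by move=> s t; exists [::] => *; rewrite !big_cat /= addrC.
- move=> n; exists [::] => L f _ L0 _ _ _ fZ; rewrite big_seq1 big_nil /=.
  by rewrite -(scale0r 0) fZ // mul0r scale0r.
- move=> m m' n; exists [:: m; m'] => L f mL L0 _ _ fD _.
  rewrite !(big_cons, big_nil) /= !addr0 fD ?scalerDl //.
    by apply: mL; rewrite inE eqxx.
  by apply: mL; rewrite !inE eqxx orbT.
- move=> m n n'; exists [::] => *.
  by rewrite !(big_cons, big_nil) /= !addr0 scalerDr.
- move=> a m n; exists [:: m] => L f mL L0 _ _ _ fZ.
  by rewrite !big_seq1 /= fZ ?scalerA 1?mulrC //; apply: mL; rewrite inE.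
Qed.

(** A substitute for tensoring with the fraction field. The equality involves a finite list [G] of
    elements of [M]; coordinates of [d *: x] on a maximal independent subfamily of [m :: G] are
    linear wherever they make sense, and one of them is nonzero at the torsion-free [m]. Its value
    there is [a]. *)
Lemma pure_torsion (M N : lmodType K) (m : M) (n : N) (s : seq (M * N)) :
  (forall a, a *: m = 0 -> a = 0) ->
  pure m n = \sum_(p <- s) pure p.1 p.2 ->
  exists2 a, a != 0 & exists b : M -> K, a *: n = \sum_(p <- s) b p.1 *: p.2.
Proof.
move=> m_free; rewrite -tens_classE /pure => /tens_classP/tens_rel_fin[G GP].
have [r [v [d [nz_d indep spn]]]] := maximal_indep (m :: G).
pose L x := in_span v (d *: x).
have coordP x : {c : 'I_r -> K | L x -> d *: x = \sum_i c i *: v i}.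
  by apply: cid; case: (pselect (L x)) => [[c dx]|nL]; [exists c | exists (fun=> 0)].
pose f x := sval (coordP x).
have fP x : L x -> d *: x = \sum_i f x i *: v i by exact: (svalP (coordP x)).
have uniqf c e : \sum_i c i *: v i = \sum_i e i *: v i -> c =1 e.
  move/eqP; rewrite -subr_eq0 -sumrB => /eqP ce0 i; apply/eqP; rewrite -subr_eq0.
  apply/eqP; apply: (indep (fun i => c i - e i)); rewrite -[RHS]ce0.
  by apply: eq_bigr => j _; rewrite scalerBl.
have LD x y : L x -> L y -> L (x + y).
  by rewrite /L scalerDr; exact: in_spanD.
have LZ a x : L x -> L (a *: x).
  by rewrite /L scalerA mulrC -scalerA; exact: in_spanZ.
have Lm : L m by apply: spn; rewrite inE eqxx.
have [i nz_i] : exists i, f m i != 0.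
  apply: contrapT => allf0; have dm0 : d *: m = 0.
    rewrite fP // big1 // => i _; apply/eqP/contraT => nz.
    by case: allf0; exists i; apply: contraNneq nz => ->; rewrite scale0r.
  by move/m_free: dm0 nz_d => ->; rewrite eqxx.
exists (f m i) => //; exists (fun x => f x i).
have := GP L (fun x => f x i); rewrite big_seq1 /=; apply=> //.
- by move=> x xG; apply: spn; rewrite inE xG orbT.
- by rewrite -(scale0r m); apply: (LZ).
- move=> x y Lx Ly; apply: (uniqf _ (fun i => f x i + f y i)).
  rewrite -fP; last exact: LD.
  rewrite scalerDr !fP // -big_split; apply: eq_bigr => j _.
  by rewrite scalerDl.
- move=> a x Lx; apply: (uniqf _ (fun i => a * f x i)).
  rewrite -fP; last exact: LZ.
  rewrite scalerA mulrC -scalerA fP // scaler_sumr.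
  by apply: eq_bigr => j _; rewrite scalerA.
Qed.
End SpanDomain.

(** * Projectivity of ID-modules *)

Lemma cauchy_l0 (V : zmodType) n (G : nat -> nat -> V) :
  (forall i j, i != 0%N -> G i j = 0) -> cauchy n G = G 0%N n.
Proof.
move=> G0; rewrite /cauchy big_ord_recl subn0 big1 ?addr0 // => i _.
exact: G0.
Qed.

Lemma cauchyMz (V : zmodType) n (G : nat -> nat -> V) (k : int) :
  cauchy n (fun i j => G i j *~ k) = cauchy n G *~ k.
Proof. by rewrite /cauchy mulrz_suml. Qed.

(* theta_T and theta_{-T} are inverse to each other. *)
Lemma cauchy_ider_inv (V : iterZmodType) n (x : V) :
  cauchy n (fun i j => ider i (ider j x) *~ (-1) ^+ j) = if n == 0%N then x else 0.
Proof.
have -> : cauchy n (fun i j => ider i (ider j x) *~ (-1) ^+ j) =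
    ider n x *~ (-1 + 1) ^+ n.
  rewrite exprDn mulrz_sumr; apply: eq_bigr => i _.
  have lin : (i <= n)%N by rewrite -ltnS.
  by rewrite expr1n mulr1 ider_comp subnKC // -mulr_natl natz mulrzA pmulrn.
by rewrite addNr; case: n => [|n]; rewrite ?expr0 ?mulr1z ?ider0n // expr0n mulr0z.
Qed.

Section DualDerivation.
Variables (S : idRingType) (M : idLmodType S).

Definition linear_form (f : M -> S) : Prop :=
  {morph f : x y / x + y} /\ forall a x, f (a *: x) = a * f x.

(* The iterative derivation of Hom_S(M, S): conjugation by theta. *)
Definition form_ider (f : M -> S) n (m : M) : S :=
  cauchy n (fun i j => ider i (f (ider j m)) *~ (-1) ^+ j).

Lemma linear_form_sum f (I : Type) (r : seq I) (F : I -> M) : linear_form f ->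
  f (\sum_(i <- r) F i) = \sum_(i <- r) f (F i).
Proof.
move=> [fD fZ]; apply: (big_morph f fD).
by rewrite -(scale0r 0) fZ mul0r.
Qed.

(** With theta_{-T} the inverse of theta_T, theta_T(f(theta_{-T}(a x))) = theta_T(theta_{-T}(a))
    theta_T(f(theta_{-T}(x))), and the first factor is [a]. *)
Lemma form_ider_linear f n : linear_form f -> linear_form (form_ider f n).
Proof.
move=> f_lin; have [fD fZ] := f_lin; split=> [x y|a x].
  by rewrite -cauchyD; apply: eq_cauchy => i j _; rewrite iderD fD iderD mulrzDl.
transitivity (cauchy n (fun i j => cauchy i (fun u v => cauchy j (fun p q =>
    (ider u (ider p a) *~ (-1) ^+ p) * (ider v (f (ider q x)) *~ (-1) ^+ q))))).
  apply: eq_cauchy => i j _; rewrite iderZ linear_form_sum // ider_sum.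
  rewrite mulrz_suml /cauchy [RHS]exchange_big /=; apply: eq_bigr => p _.
  rewrite fZ iderM mulrz_suml; apply: eq_bigr => u _.
  by rewrite mulrzAl mulrzAr -mulrzA mulrC -exprD subnK // -ltnS.
rewrite (cauchyACA _ (fun u v p q =>
  (ider u (ider p a) *~ (-1) ^+ p) * (ider v (f (ider q x)) *~ (-1) ^+ q))).
transitivity (cauchy n (fun k l => (if k == 0%N then a else 0) * form_ider f l x)).
  apply: eq_cauchy => k l _; rewrite -cauchy_ider_inv /cauchy mulr_suml.
  by apply: eq_bigr => u _; rewrite mulr_sumr.
by rewrite cauchy_l0 //= => i j /negPf ->; rewrite mul0r.
Qed.

(** Both sides are the T^n-coefficient of theta_T(s theta_{-T}(m)): semilinearity of theta gives
    theta_T(s) m, and expanding multiplication by [s] along [L] first gives the right-hand side.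
    Hence the derivatives of [s] again factor through a finite free module. *)
Lemma form_ider_dual (s : S) (L : seq ((M -> S) * M)) n (m : M) :
  (forall x, s *: x = \sum_(p <- L) p.1 x *: p.2) ->
  ider n s *: m =
    \sum_(p <- L) cauchy n (fun i j => form_ider p.1 i m *: ider j p.2).
Proof.
move=> sL.
have <- : cauchy n (fun i j => ider i (s *: ider j m) *~ (-1) ^+ j) = ider n s *: m.
  transitivity (cauchy n (fun i j => cauchy i (fun a b =>
      ider a s *: (ider b (ider j m) *~ (-1) ^+ j)))).
    apply: eq_cauchy => i j _; rewrite iderZ -cauchyMz.
    by apply: eq_cauchy => a b _; rewrite scalerMzr.
  rewrite (cauchyA _ (fun a b j => ider a s *: (ider b (ider j m) *~ (-1) ^+ j))).
  transitivity (cauchy n (fun k a => ider a s *: (if k == 0%N then m else 0))).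
    rewrite cauchyC; apply: eq_cauchy => k a _.
    by rewrite -cauchy_ider_inv /cauchy scaler_sumr.
  by rewrite cauchy_l0 // => i j /negPf ->; rewrite scaler0.
rewrite -(cauchy_sum L n (fun p i j => form_ider p.1 i m *: ider j p.2)).
transitivity (cauchy n (fun i j => cauchy i (fun b a =>
    \sum_(p <- L) (ider a (p.1 (ider j m)) *~ (-1) ^+ j) *: ider b p.2))).
  apply: eq_cauchy => i j _; rewrite sL ider_sum mulrz_suml cauchy_sum.
  apply: eq_bigr => p _; rewrite iderZ [RHS]cauchyC -cauchyMz.
  by apply: eq_cauchy => a b _; rewrite scalerMzl.
rewrite (cauchyA _ (fun b a j =>
    \sum_(p <- L) (ider a (p.1 (ider j m)) *~ (-1) ^+ j) *: ider b p.2)) cauchyC.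
apply: eq_cauchy => i b _; rewrite cauchy_sum; apply: eq_bigr => p _.
by rewrite /form_ider /cauchy scaler_suml.
Qed.
End DualDerivation.

(* The s in S such that s * id_M factors through a finite free module form an
   ID-ideal. It is nonzero because a maximal independent subfamily of a finite
   generating family of M spans M up to a nonzero denominator. *)
Lemma dual_basis (S : idRingType) (M : idModType S) : idsimple S ->
  exists (N : nat) (f : 'I_N -> M -> S) (v : 'I_N -> M),
    (forall i, linear_form (f i)) /\ forall m, m = \sum_i f i m *: v i.
Proof.
move=> simpleS; have domS := idsimple_domain simpleS.
pose I s := exists L : seq ((M -> S) * M),
  (forall p, List.In p L -> linear_form p.1) /\
  forall x, s *: x = \sum_(p <- L) p.1 x *: p.2.
have [s nz_s Is] : exists2 s, s != 0 & I s.
  have [k [w genM]] := @fin_gen _ M.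
  have [r [v [d [nz_d indep spn]]]] := maximal_indep domS [seq w i | i <- enum 'I_k].
  have dM x : in_span v (d *: x).
    have [c ->] := genM x; rewrite scaler_sumr.
    elim/big_ind: _ => [||i _]; first by exists (fun=> 0); rewrite big1 // => i; rewrite scale0r.
      exact: in_spanD.
    rewrite scalerA mulrC -scalerA; apply/in_spanZ/spn/mapP.
    by exists i; rewrite ?mem_enum.
  have [f fP] := choice dM.
  have uniqf (c e : 'I_r -> S) : \sum_i c i *: v i = \sum_i e i *: v i -> c =1 e.
    move/eqP; rewrite -subr_eq0 -sumrB => /eqP ce0 i; apply/eqP; rewrite -subr_eq0.
    apply/eqP; apply: (indep (fun i => c i - e i)); rewrite -[RHS]ce0.
    by apply: eq_bigr => j _; rewrite scalerBl.
  exists d => //; exists [seq (f^~ i, v i) | i <- enum 'I_r].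
  split=> [p|x]; last by rewrite big_map big_enum /= fP.
  case/List.in_map_iff => i [<- _] /=; split=> [x y|a x].
    move: i; apply: (uniqf _ (fun i => f x i + f y i)); rewrite -fP.
    by rewrite scalerDr !fP -big_split; apply: eq_bigr => j _; rewrite scalerDl.
  move: i; apply: (uniqf _ (fun i => a * f x i)); rewrite -fP.
  rewrite scalerA mulrC -scalerA fP scaler_sumr.
  by apply: eq_bigr => j _; rewrite scalerA.
have [L [linL mL]] : I 1.
  apply: (idsimple_ideal1 simpleS _ _ _ _ nz_s Is).
  - by exists [::]; split=> // x; rewrite big_nil scale0r.
  - move=> a b [L [linL aL]] [L' [linL' bL']]; exists (L ++ L'); split=> [p|x].
      by case/List.in_app_iff => [/linL|/linL'].
    by rewrite scalerDl aL bL' big_cat.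
  - move=> a b [L [linL bL]]; exists [seq (p.1, a *: p.2) | p <- L]; split=> [p|x].
      by case/List.in_map_iff => q [<- /linL].
    rewrite -scalerA bL big_map scaler_sumr; apply: eq_bigr => p _ /=.
    by rewrite !scalerA mulrC.
  - move=> n a [L [linL aL]].
    exists [seq (form_ider p.1 (nat_of_ord i), ider (n - i)%N p.2) | p <- L, i <- enum 'I_n.+1].
    split=> [q|x]; last first.
      rewrite (form_ider_dual _ _ aL) big_allpairs_dep; apply: eq_bigr => p _ /=.
      by rewrite big_enum.
    case/List.in_concat => _ [/List.in_map_iff[p [<- pL]]].
    by case/List.in_map_iff => i [<- _]; exact/form_ider_linear/linL.
exists (size L), (fun i => (tnth (in_tuple L) i).1), (fun i => (tnth (in_tuple L) i).2).
split=> [i|m]; last by rewrite -[LHS]scale1r mL big_tnth.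
apply: linL; rewrite (tnth_nth (fun=> 0, 0)) /=.
have: (i < size L)%N by [].
by move: (i : nat) => {i}; elim: (L) => [|p L' IH] [|i] //= ilt; [left|right; apply: IH].
Qed.

(** * Submodules of trivial ID-modules *)

Section ConstantVectors.
Variables (R : idRingType) (simpleR : idsimple R) (m : nat) (U : ('I_m -> R) -> Prop).
Hypothesis UD : forall a u v, U u -> U v -> U (fun k => u k + a * v k).
Hypothesis Uider : forall n u, U u -> U (fun k => ider n (u k)).

Let supp (u : 'I_m -> R) := [set k | u k != 0].

(* In a vector of U of minimal support, some coordinate can be made 1 because R
   is ID-simple; its derivatives then have smaller support, so vanish. *)
Lemma exists_const_vector u i : U u -> u i != 0 ->
  exists v j, [/\ U v, forall k, is_const (v k), v j = 1 & supp v \subset supp u].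
Proof.
have [n] := ubnP #|supp u|; elim: n u i => // n IHn u i un Uu nz_i.
have UZ a v : U v -> U (fun k => a * v k).
  move=> Uv; have := UD (a - 1) Uv Uv; congr (U _); apply/funext => k.
  by rewrite mulrBl mul1r addrC subrK.
have U0 : U (fun=> 0).
  by have := UZ 0 u Uu; congr (U _); apply/funext => k; rewrite mul0r.
(* The ID-ideal in question consists of the [i]-th coordinates of the vectors of [U] supported
   inside [supp u]; it contains [u i]. *)
have [v [Uv vu vi]] : exists v, [/\ U v, supp v \subset supp u & v i = 1].
  apply: (@idsimple_ideal1 _ simpleR
    (fun x => exists v, [/\ U v, supp v \subset supp u & v i = x]) (u i)) => //.
  - by exists (fun=> 0); split=> //; apply/subsetP => k; rewrite inE eqxx.
  - move=> x y [v [Uv vu <-]] [w [Uw wu <-]].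
    exists (fun k => v k + 1 * w k); split; [exact: UD| |by rewrite mul1r].
    apply/subsetP => k; apply: contraLR => uk; rewrite inE mul1r.
    have /negP := uk; rewrite negbK.
    have: k \notin supp v by apply: contra uk; apply: (subsetP vu).
    have: k \notin supp w by apply: contra uk; apply: (subsetP wu).
    by rewrite !inE !negbK => /eqP -> /eqP ->; rewrite addr0 eqxx.
  - move=> a x [v [Uv vu <-]]; exists (fun k => a * v k); split; [exact: UZ| |by []].
    apply: subset_trans vu; apply/subsetP => k; rewrite !inE.
    by apply: contraNneq => ->; rewrite mulr0.
  - move=> l x [v [Uv vu <-]]; exists (fun k => ider l (v k)); split; [exact: Uider| |by []].
    apply: subset_trans vu; apply/subsetP => k; rewrite !inE.
    by apply: contraNneq => ->; rewrite ider_0.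
  - by exists u.
case: (pselect (forall k, is_const (v k))) => [cv|ncv].
  by exists v, i.
have [l [k]] : exists l k, ider l.+1 (v k) != 0.
  apply: contrapT => cv; apply: ncv => k [|l]; first by rewrite ider0n.
  by apply: contrapT => /eqP nz; apply: cv; exists l, k.
pose w k := ider l.+1 (v k); rewrite -[ider _ _]/(w k) => nz_wk.
have wv : supp w \subset supp v.
  by apply/subsetP => h; rewrite !inE; apply: contraNneq; rewrite /w => ->; rewrite ider_0.
have ltw : (#|supp w| < n)%N.
  rewrite -ltnS; apply: leq_trans un; rewrite ltnS; apply: proper_card.
  apply/properP; split; first exact: subset_trans vu.
  by exists i; rewrite inE // negbK /w vi ider1.
have [x [j [Ux cx xj xw]]] := IHn _ k ltw (Uider _ Uv) nz_wk.
exists x, j; split=> //; apply: subset_trans xw _; exact: subset_trans vu.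
Qed.

(** Subtracting [u j] times a constant vector with [j]-th entry 1 empties coordinate [j] and does
    not enlarge the support. The predicate [P] keeps track of where the coefficients lie: they are
    coordinates of successive vectors, which change only by terms [u j * c] with [c] constant. *)
Lemma const_vectors_span (P : R -> Prop) u :
  (forall x y c, P x -> P y -> is_const c -> P (x - y * c)) ->
  U u -> (forall k, P (u k)) ->
  exists L : seq (R * ('I_m -> R)),
    (forall t, List.In t L -> [/\ P t.1, U t.2 & forall k, is_const (t.2 k)]) /\
    forall k, u k = \sum_(t <- L) t.1 * t.2 k.
Proof.
move=> PB; have [n] := ubnP #|supp u|; elim: n u => // n IHn u un Uu Pu.
case: (pselect (exists i, u i != 0)) => [[i nz_i]|u0]; last first.
  exists [::]; split=> // k; rewrite big_nil; apply/eqP/contraT => nz.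
  by case: u0; exists k.
have [v [j [Uv cv vj vu]]] := exists_const_vector Uu nz_i.
pose w k := u k + (- u j) * v k.
have wE k : w k = u k - u j * v k by rewrite /w mulNr.
have wu : supp w \subset supp u.
  apply/subsetP => k; apply: contraLR => uk; rewrite inE wE negbK.
  have: k \notin supp v by apply: contra uk; apply: (subsetP vu).
  by move: uk; rewrite !inE !negbK => /eqP -> /eqP ->; rewrite mulr0 subr0.
have ltw : (#|supp w| < n)%N.
  rewrite -ltnS; apply: leq_trans un; rewrite ltnS; apply: proper_card.
  apply/properP; split=> //; exists j; last by rewrite inE negbK wE vj mulr1 subrr.
  by apply: (subsetP vu); rewrite inE vj oner_neq0.
have [||L [LP wL]] := IHn w ltw; first exact: UD.
  by move=> k; rewrite wE; apply: PB.
exists ((u j, v) :: L); split=> [t [<-|/LP //]|k]; first by split=> /=.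
by rewrite big_cons -wL wE /= addrC subrK.
Qed.
End ConstantVectors.

Section ConstSpan.
Variables (R : idRingType) (Q : idPzRingType) (iota : {rmorphism R -> Q}).
Implicit Types (P : R -> Prop) (V J : Q -> Prop).

(** The coefficients are restricted to [P], not just to [R], because some spans must have
    coefficients in the fundamental subalgebra while others may use all of [R]. *)
Inductive lin_span P V : Q -> Prop :=
| lin_span0 : lin_span P V 0
| lin_spanDl r a z :
    P r -> V a -> lin_span P V z -> lin_span P V (iota r * a + z).

Lemma lin_spanP P V z : lin_span P V z <->
  exists m (r : 'I_m -> R) (a : 'I_m -> Q),
    [/\ forall k, P (r k), forall k, V (a k) & z = \sum_k iota (r k) * a k].
Proof.
split=> [|[m [r [a [Pr Va ->]]]]]; last first.
  elim: m r a Pr Va => [|m IHm] r a Pr Va; first by rewrite big_ord0; exact: lin_span0.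
  by rewrite big_ord_recl; apply: lin_spanDl => //; apply: IHm.
elim=> {z} [|r a z Pr Va _ [m [s [b [Ps Vb ->]]]]].
  by exists 0%N, (fun=> 0), (fun=> 0); split=> [[]|[]|] //; rewrite big_ord0.
exists m.+1, (fun k => oapp s r (unlift ord0 k)), (fun k => oapp b a (unlift ord0 k)).
split=> [k|k|]; try by case: unliftP => //=.
rewrite big_ord_recl unlift_none /=; congr (_ + _).
by apply: eq_bigr => k _; rewrite liftK.
Qed.

Lemma lin_span1 P V r a : P r -> V a -> lin_span P V (iota r * a).
Proof.
by move=> Pr Va; rewrite -[_ * _]addr0; apply: lin_spanDl => //; exact: lin_span0.
Qed.

Lemma lin_spanD P V x y : lin_span P V x -> lin_span P V y -> lin_span P V (x + y).
Proof.
move=> Px Py; elim: Px => [|r a z Pr Va _ IH]; first by rewrite add0r.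
by rewrite -addrA; exact: lin_spanDl.
Qed.

Lemma lin_spanN P V z :
  (forall r, P r -> P (- r)) -> lin_span P V z -> lin_span P V (- z).
Proof.
move=> PN; elim=> [|r a y Pr Va _ IH]; first by rewrite oppr0; exact: lin_span0.
by rewrite opprD -mulNr -rmorphN; apply: lin_spanDl => //; exact: PN.
Qed.

Lemma lin_span_sum P V (I : Type) (s : seq I) (F : I -> Q) :
  (forall i, lin_span P V (F i)) -> lin_span P V (\sum_(i <- s) F i).
Proof.
by move=> PF; elim/big_ind: _ => //; [exact: lin_span0 | exact: lin_spanD].
Qed.

Lemma lin_span_mono P P' V V' z :
  (forall r, P r -> P' r) -> (forall a, V a -> V' a) ->
  lin_span P V z -> lin_span P' V' z.
Proof.
move=> PP' VV'; elim=> [|r a y Pr Va _ IH]; first exact: lin_span0.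
by apply: lin_spanDl => //; [exact: PP' | exact: VV'].
Qed.

Lemma lin_spanM P V x y :
  (forall r s, P r -> P s -> P (r * s)) -> (forall a b, V a -> V b -> V (a * b)) ->
  lin_span P V x -> lin_span P V y -> lin_span P V (x * y).
Proof.
move=> PM VM Px Py; elim: Px => [|r a z Pr Va _ IHz].
  by rewrite mul0r; exact: lin_span0.
rewrite mulrDl; apply: lin_spanD => // {z IHz}.
elim: Py => [|s b z Ps Vb _ IHz]; first by rewrite mulr0; exact: lin_span0.
rewrite mulrDr; apply: lin_spanD => //.
by rewrite mulrACA -rmorphM; apply: lin_span1; [exact: PM | exact: VM].
Qed.

Section Ider.
Hypothesis iota_ider : commutes_ider iota.

Lemma ider_mul_const n r a : is_const a -> ider n (iota r * a) = iota (ider n r) * a.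
Proof.
move=> ca; rewrite iderM /cauchy big_ord_recr /= subnn ider0n iota_ider.
by rewrite big1 ?add0r // => i _; rewrite ca subn_eq0 leqNgt ltn_ord mulr0.
Qed.

Lemma lin_span_ider P V n x :
  (forall r, P r -> P (ider n r)) -> (forall a, V a -> is_const a) ->
  lin_span P V x -> lin_span P V (ider n x).
Proof.
move=> Pi Vc; elim=> [|r a z Pr Va _ IHz]; first by rewrite ider_0; exact: lin_span0.
rewrite iderD; apply: lin_spanD => //; rewrite ider_mul_const; last exact: Vc.
by apply: lin_span1 => //; exact: Pi.
Qed.

Section Submodule.
Hypothesis simpleR : idsimple R.

(** The vectors [u] with [\sum_k iota (u k) * a k] in [J] are stable under linear combinations and,
    the [a k] being constant, under derivation, so [const_vectors_span] applies. When [J] is zero,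
    relations between constants are thus combinations of relations with constant coefficients. *)
Lemma const_relations P J m (r : 'I_m -> R) (a : 'I_m -> Q) :
  (forall x y c, P x -> P y -> is_const c -> P (x - y * c)) ->
  (forall x y, J x -> J y -> J (x + y)) -> (forall s x, J x -> J (iota s * x)) ->
  (forall n x, J x -> J (ider n x)) ->
  (forall k, P (r k)) -> (forall k, is_const (a k)) -> J (\sum_k iota (r k) * a k) ->
  exists L : seq (R * ('I_m -> R)),
    (forall t, List.In t L ->
      [/\ P t.1, J (\sum_k iota (t.2 k) * a k) & forall k, is_const (t.2 k)]) /\
    forall k, r k = \sum_(t <- L) t.1 * t.2 k.
Proof.
move=> PB JD JZ Jider Pr ca Jr.
apply: (const_vectors_span simpleR (U := fun u => J (\sum_k iota (u k) * a k))) => //.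
- move=> s u v Ju Jv; under eq_bigr do rewrite rmorphD rmorphM mulrDl -mulrA.
  by rewrite big_split -mulr_sumr; apply: JD => //; apply: JZ.
- move=> n u Ju; under eq_bigr do rewrite -ider_mul_const //.
  by rewrite -ider_sum; exact: Jider.
Qed.

Definition const_submod V : Prop :=
  [/\ forall a, V a -> is_const a, V 0, forall a b, V a -> V b -> V (a + b)
    & forall c a, is_const c -> V a -> V (iota c * a)].

Lemma const_submod_sum V m (c : 'I_m -> R) (a : 'I_m -> Q) : const_submod V ->
  (forall k, is_const (c k)) -> (forall k, V (a k)) -> V (\sum_k iota (c k) * a k).
Proof. by move=> [_ V0 VD VZ] cc Va; elim/big_ind: _ => // k _; apply: VZ. Qed.

(* An ID-submodule of the trivial module R (x) V is spanned by its constants. *)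
Lemma lin_span_sub P V J z : const_submod V ->
  (forall x y c, P x -> P y -> is_const c -> P (x - y * c)) ->
  (forall x y, J x -> J y -> J (x + y)) -> (forall s x, J x -> J (iota s * x)) ->
  (forall n x, J x -> J (ider n x)) ->
  lin_span P V z -> J z -> lin_span P (fun a => V a /\ J a) z.
Proof.
move=> Vsub PB JD JZ Jider /lin_spanP[m [r [a [Pr Va ->]]]] Jz.
have [Vc _ _ _] := Vsub.
have [L [LP rL]] := const_relations PB JD JZ Jider Pr (fun k => Vc _ (Va k)) Jz.
have -> : \sum_k iota (r k) * a k =
    \sum_(t <- L) iota t.1 * \sum_k iota (t.2 k) * a k.
  under eq_bigr do rewrite rL rmorph_sum mulr_suml.
  rewrite exchange_big; apply: eq_bigr => t _; rewrite mulr_sumr.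
  by apply: eq_bigr => k _; rewrite rmorphM mulrA.
elim: L LP {rL} => [|t L IHL] LP; first by rewrite big_nil; exact: lin_span0.
rewrite big_cons; apply: lin_spanDl; last by apply: IHL => s sL; apply: LP; right.
  by have [] := LP t; first by left.
have [|_ Jt ct] := LP t; first by left.
by split=> //; exact: const_submod_sum.
Qed.

(** The relation between [z] and the [a k] is a combination of relations with constant coefficients;
    since [j] is nonzero, one of these has a nonzero coefficient at [z]. That coefficient is a
    nonzero constant, hence invertible with constant inverse, and [z] can be solved for. With
    [j = 1] this determines the constants of a span. *)
Lemma lin_span_const V j z : const_submod V -> j != 0 -> is_const z ->
  lin_span (fun=> True) V (iota j * z) -> V z.
Proof.
move=> Vsub nz_j cz /lin_spanP[m [r [a [_ Va jz]]]].
have [Vc V0 VD VZ] := Vsub.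
pose r' (k : 'I_m.+1) := oapp r j (unlift ord0 k).
pose a' (k : 'I_m.+1) := oapp (fun k => - a k) z (unlift ord0 k).
have VN b : V b -> V (- b).
  move=> Vb; rewrite -mulN1r -(rmorph1 iota) -rmorphN; apply: VZ => //.
  by move=> n; rewrite iderN ider1; case: n => //= n; rewrite oppr0.
have ca' k : is_const (a' k).
  by rewrite /a'; case: unliftP => //= i _; apply/Vc/VN.
have z0 : \sum_k iota (r' k) * a' k = 0.
  rewrite big_ord_recl /r' /a' unlift_none /= jz; apply/eqP.
  rewrite addr_eq0 -sumrN; apply/eqP; apply: eq_bigr => k _.
  by rewrite liftK /= mulrN opprK.
have [|||||L [LP r'L]] := @const_relations (fun=> True) (eq^~ 0) _ r' a' _ _ _ _ _ ca' z0 => //.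
- by move=> x y -> ->; rewrite addr0.
- by move=> s x ->; rewrite mulr0.
- by move=> n x ->; rewrite ider_0.
have [t tL nz_t] : exists2 t, List.In t L & t.2 ord0 != 0.
  apply: contrapT => nt; move/eqP: nz_j; apply.
  have := r'L ord0; rewrite /r' unlift_none /= => ->.
  elim: L nt {LP r'L} => [|t L IHL] nt; first by rewrite big_nil.
  rewrite big_cons IHL ?addr0 => [|[s sL nz_s]]; last by apply: nt; exists s => //; right.
  apply/eqP/contraT => nz; case: nt; exists t; first by left.
  by apply: contraNneq nz => ->; rewrite mulr0.
have [_ t0 ct] := LP t tL.
have [d cd dt] := idsimple_const_inv simpleR (ct ord0) nz_t.
have -> : z = iota d * \sum_(k < m) iota (t.2 (lift ord0 k)) * a k.
  move: t0; rewrite big_ord_recl /a' unlift_none /= => /eqP; rewrite addr_eq0 -sumrN => /eqP t0.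
  rewrite -[LHS]mul1r -(rmorph1 iota) -dt rmorphM -mulrA t0; congr (_ * _).
  by apply: eq_bigr => k _; rewrite liftK /= mulrN opprK.
by apply: VZ => //; exact: const_submod_sum.
Qed.
End Submodule.
End Ider.
End ConstSpan.

(** * ID-subalgebras *)

Record idsubalg (S : idRingType) (R : idAlgType S) := IDSubalg {
  isub_mem :> R -> Prop;
  isub_alg : forall s : S, isub_mem s%:A;
  isubB : forall x y, isub_mem x -> isub_mem y -> isub_mem (x - y);
  isubM : forall x y, isub_mem x -> isub_mem y -> isub_mem (x * y);
  isub_ider : forall n x, isub_mem x -> isub_mem (ider n x)
}.

Section SubAlgebra.
Variables (S : idRingType) (R : idAlgType S) (B : idsubalg R).

Definition isub_pred : {pred R} := fun x => `[< B x >].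

Lemma isub_predP x : reflect (B x) (x \in isub_pred).
Proof. exact: asboolP. Qed.

Fact isub_subring : subring_closed isub_pred.
Proof.
split=> [|x y /isub_predP Bx /isub_predP By|x y /isub_predP Bx /isub_predP By];
  apply/isub_predP; [|exact: isubB|exact: isubM].
by rewrite -[1]scale1r; exact: isub_alg.
Qed.

Record isub := ISub { ival : R; ivalP : ival \in isub_pred }.
HB.instance Definition _ := [isSub for ival].
HB.instance Definition _ := [Choice of isub by <:].
HB.instance Definition _ :=
  GRing.SubChoice_isSubComNzRing.Build R isub_pred isub isub_subring.

Fact ival_zmod : zmod_morphism ival. Proof. by []. Qed.
Fact ival_monoid : monoid_morphism ival. Proof. by []. Qed.
HB.instance Definition _ := GRing.isZmodMorphism.Build isub R ival ival_zmod.
HB.instance Definition _ := GRing.isMonoidMorphism.Build isub R ival ival_monoid.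

Lemma ival_mem (x : isub) : B (ival x). Proof. exact/isub_predP/ivalP. Qed.

Fact isub_scale_subproof (s : S) (x : isub) : s *: ival x \in isub_pred.
Proof.
apply/isub_predP; rewrite -[_ *: _]mulr_algl; apply: isubM; first exact: isub_alg.
exact: ival_mem.
Qed.
Definition isub_scale s x : isub := ISub (isub_scale_subproof s x).

Fact isub_scaleA a b x : isub_scale a (isub_scale b x) = isub_scale (a * b) x.
Proof. by apply: val_inj; rewrite /= scalerA. Qed.
Fact isub_scale1 : left_id 1 isub_scale.
Proof. by move=> x; apply: val_inj; rewrite /= scale1r. Qed.
Fact isub_scaleDr : right_distributive isub_scale +%R.
Proof. by move=> a x y; apply: val_inj; rewrite /= scalerDr. Qed.
Fact isub_scaleDl x : {morph isub_scale^~ x : a b / a + b}.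
Proof. by move=> a b; apply: val_inj; rewrite /= scalerDl. Qed.
HB.instance Definition _ := GRing.Zmodule_isLmodule.Build S isub
  isub_scaleA isub_scale1 isub_scaleDr isub_scaleDl.

Fact isub_scaleAl (a : S) (x y : isub) : a *: (x * y) = a *: x * y.
Proof. by apply: val_inj; rewrite /= scalerAl. Qed.
HB.instance Definition _ := GRing.Lmodule_isLalgebra.Build S isub isub_scaleAl.
HB.instance Definition _ := GRing.Lalgebra_isComAlgebra.Build S isub.

Fact isub_ider_subproof n (x : isub) : ider n (ival x) \in isub_pred.
Proof. exact/isub_predP/isub_ider/ival_mem. Qed.
Definition isub_iter n x : isub := ISub (isub_ider_subproof n x).

Fact isub_iterD n : {morph isub_iter n : x y / x + y}.
Proof. by move=> x y; apply: val_inj; rewrite /= iderD. Qed.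
Fact isub_iter0n x : isub_iter 0 x = x.
Proof. by apply: val_inj; rewrite /= ider0n. Qed.
Fact isub_iter_comp i j x :
  isub_iter i (isub_iter j x) = isub_iter (i + j) x *+ 'C(i + j, i).
Proof. by apply: val_inj; rewrite /= ider_comp; rewrite -[RHS]/(ival _) raddfMn. Qed.
HB.instance Definition _ :=
  hasIterDer.Build isub isub_iterD isub_iter0n isub_iter_comp.

Lemma ival_cauchy n (G : nat -> nat -> isub) :
  ival (cauchy n G) = cauchy n (fun i j => ival (G i j)).
Proof. exact: (raddf_sum ival). Qed.

Fact isub_iter1 n : ider n (1 : isub) = (n == 0%N)%:R.
Proof. by apply: val_inj; rewrite /= ider1; case: n. Qed.
Fact isub_iterM n (x y : isub) :
  ider n (x * y) = cauchy n (fun i j => ider i x * ider j y).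
Proof. by apply: val_inj; rewrite [RHS]ival_cauchy /= iderM. Qed.
HB.instance Definition _ := isIDRing.Build isub isub_iter1 isub_iterM.

Fact isub_iterZ n (a : S) (x : isub) :
  ider n (a *: x) = cauchy n (fun i j => ider i a *: ider j x).
Proof. by apply: val_inj; rewrite [RHS]ival_cauchy /= iderZ. Qed.
HB.instance Definition _ := isIDLmod.Build S isub isub_iterZ.

Fact ival_scalable : scalable ival. Proof. by []. Qed.
HB.instance Definition _ := GRing.isScalable.Build S isub R *:%R ival ival_scalable.

Lemma ival_ider : commutes_ider ival. Proof. by []. Qed.
Definition ival_lrmorphism : {lrmorphism isub -> R} := ival.
Definition isub_idAlg : idAlgType S := isub.
End SubAlgebra.

(** * The two fundamental matrices over the tensor square *)

Section TensorSquareMaps.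
Variables (S : idRingType) (R : idAlgType S).

Definition iotal (r : R) : tens_sq R := tpure r 1.
Definition iotar (r : R) : tens_sq R := tpure 1 r.

Fact iotal_zmod : zmod_morphism iotal.
Proof.
move=> r s; apply: (addIr (iotal s)); rewrite subrK.
by rewrite /iotal -[X in X = _]pureDl subrK.
Qed.
Fact iotal_monoid : monoid_morphism iotal.
Proof. by split=> // r s; rewrite /iotal [RHS]tpureM mulr1. Qed.
HB.instance Definition _ := GRing.isZmodMorphism.Build R (tens_sq R) iotal iotal_zmod.
HB.instance Definition _ := GRing.isMonoidMorphism.Build R (tens_sq R) iotal iotal_monoid.

Fact iotar_zmod : zmod_morphism iotar.
Proof.
move=> r s; apply: (addIr (iotar s)); rewrite subrK.
by rewrite /iotar -[X in X = _]pureDr subrK.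
Qed.
Fact iotar_monoid : monoid_morphism iotar.
Proof. by split=> // r s; rewrite /iotar [RHS]tpureM mulr1. Qed.
HB.instance Definition _ := GRing.isZmodMorphism.Build R (tens_sq R) iotar iotar_zmod.
HB.instance Definition _ := GRing.isMonoidMorphism.Build R (tens_sq R) iotar iotar_monoid.

Lemma iotal_ider : commutes_ider iotal.
Proof.
move=> n r; rewrite [RHS]ider_tpure cauchyC cauchy_l0 ?ider0n // => -[|i] j //= _.
by rewrite ider1 /tpure pure0r.
Qed.

Lemma iotar_ider : commutes_ider iotar.
Proof.
move=> n r; rewrite [RHS]ider_tpure cauchy_l0 ?ider0n // => -[|i] j //= _.
by rewrite ider1 /tpure pure0l.
Qed.

Lemma iota_tpure r s : iotal r * iotar s = tpure r s.
Proof. by rewrite [LHS]tpureM mulr1 mul1r. Qed.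

Lemma iotar_alg (s : S) : iotar s%:A = iotal s%:A.
Proof. by rewrite /iotar /iotal /tpure pureZ. Qed.
Lemma iotarZ (s : S) r : iotar (s *: r) = iotal s%:A * iotar r.
Proof. by rewrite iota_tpure /iotar /tpure -pureZ. Qed.

Lemma iotalZ (s : S) r : iotal (s *: r) = iotal r * iotar s%:A.
Proof. by rewrite iota_tpure /iotal /tpure -pureZ. Qed.
End TensorSquareMaps.

Section Evaluation.
Variables (S : idRingType) (A : idAlgType S) (M : idLmodType S) (f : M -> S).
Hypothesis f_lin : linear_form f.

Definition form_ext : bchange A M -> A := tens_lift (fun a m => f m *: a).

Let ext_balanced : balanced_map (fun (a : A) m => f m *: a).
Proof.
have [fD fZ] := f_lin; split=> [m a b|a m m'|k a m]; first by rewrite scalerDr.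
  by rewrite fD scalerDl.
by rewrite fZ scalerA mulrC.
Qed.

Lemma form_ext_pure a m : form_ext (pure a m) = f m *: a.
Proof. exact: tens_lift_pure. Qed.

Lemma form_extD : {morph form_ext : x y / x + y}.
Proof. exact: tens_liftD. Qed.

Lemma form_extZ a x : form_ext (a *: x) = a * form_ext x.
Proof.
elim/tens_ind: x => [b m|x y IHx IHy]; last first.
  by rewrite scalerDr !form_extD IHx IHy mulrDr.
by rewrite bchange_scale_pure !form_ext_pure scalerAr.
Qed.

Lemma form_ext_sum (I : Type) (r : seq I) (F : I -> bchange A M) :
  form_ext (\sum_(i <- r) F i) = \sum_(i <- r) form_ext (F i).
Proof.
apply: (big_morph form_ext form_extD).
by apply: (addIr (form_ext 0)); rewrite -form_extD !add0r.
Qed.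
End Evaluation.

Section DualBasis.
Variables (S : idRingType) (M : idLmodType S) (N : nat) (f : 'I_N -> M -> S) (v : 'I_N -> M).
Hypotheses (f_lin : forall l, linear_form (f l)) (fv : forall m, m = \sum_l f l m *: v l).

Lemma bchange_dual_basis (A : idAlgType S) (x : bchange A M) :
  x = \sum_l pure (form_ext (f l) x) (v l).
Proof.
elim/tens_ind: x => [a m|x y IHx IHy]; last first.
  rewrite {1}IHx {1}IHy -big_split; apply: eq_bigr => l _.
  by rewrite form_extD // [RHS]pureDl.
rewrite {1}[m]fv pure_sumr; apply: eq_bigr => l _.
by rewrite form_ext_pure // pureZ.
Qed.
End DualBasis.

Section FundamentalMatrix.
Variables (S : idRingType) (R : idAlgType S) (M : idModType S).
Variables (n : nat) (e : 'I_n -> bchange R M).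
Hypothesis e_const : forall i, is_const (e i).
Hypothesis e_basis :
  forall z : bchange R M, exists! c : {ffun 'I_n -> R}, z = \sum_i c i *: e i.
Variables (N : nat) (f : 'I_N -> M -> S) (v : 'I_N -> M).
Hypotheses (f_lin : forall l, linear_form (f l)) (fv : forall m, m = \sum_l f l m *: v l).

Fact bcoord_subproof (z : bchange R M) :
  exists c : {ffun 'I_n -> R}, z = \sum_i c i *: e i.
Proof. by have [c [zc _]] := e_basis z; exists c. Qed.

Definition bcoord z : 'I_n -> R := sval (cid (bcoord_subproof z)).

Lemma bcoordP z : z = \sum_i bcoord z i *: e i.
Proof. exact: svalP (cid (bcoord_subproof z)). Qed.

Lemma bcoord_uniq z (c : 'I_n -> R) : z = \sum_i c i *: e i -> c =1 bcoord z.
Proof.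
move=> zc i; have [d [_ uniq_d]] := e_basis z.
have <- : finfun c i = c i by rewrite ffunE.
have <- : finfun (bcoord z) i = bcoord z i by rewrite ffunE.
congr (fun_of_fin _ i); transitivity d; [apply: esym|]; apply: uniq_d.
  by rewrite {1}zc; apply: eq_bigr => k _; rewrite ffunE.
by rewrite {1}[z]bcoordP; apply: eq_bigr => k _; rewrite ffunE.
Qed.

Lemma bcoordD x y i : bcoord (x + y) i = bcoord x i + bcoord y i.
Proof.
apply/esym/(bcoord_uniq (c := fun i => bcoord x i + bcoord y i)).
by rewrite {1}[x]bcoordP {1}[y]bcoordP -big_split; apply: eq_bigr => k _; rewrite scalerDl.
Qed.

Lemma bcoordZ a x i : bcoord (a *: x) i = a * bcoord x i.
Proof.
apply/esym/(bcoord_uniq (c := fun i => a * bcoord x i)).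
by rewrite {1}[x]bcoordP scaler_sumr; apply: eq_bigr => k _; rewrite scalerA.
Qed.

Lemma bcoord_ider k z i : bcoord (ider k z) i = ider k (bcoord z i).
Proof.
apply/esym/(bcoord_uniq (c := fun i => ider k (bcoord z i))).
rewrite {1}[z]bcoordP ider_sum; apply: eq_bigr => j _.
rewrite iderZ cauchyC cauchy_l0 ?e_const //= => -[|p] q // _.
by rewrite e_const scaler0.
Qed.

(** If [M] is free on [v], then [dsol] is a fundamental solution matrix and [sol] on the [v l] is
    its inverse. In general their product summed over the basis index is only the idempotent matrix
    of the [f l (v k)], see [sol_dsol]. *)
Definition sol (m : M) i : R := bcoord (pure 1 m) i.
Definition dsol (l : 'I_N) j : R := form_ext (f l) (e j).

Lemma solD m m' i : sol (m + m') i = sol m i + sol m' i.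
Proof. by rewrite /sol pureDr; exact: bcoordD. Qed.

Lemma solZ a m i : sol (a *: m) i = a *: sol m i.
Proof.
rewrite /sol -pureZ -[a *: 1]mulr1 -[X in bcoord X]bchange_scale_pure bcoordZ.
by rewrite mulr_algl.
Qed.

Lemma bcoord_pure r m i : bcoord (pure r m) i = r * sol m i.
Proof. by rewrite -bcoordZ bchange_scale_pure mulr1. Qed.

Lemma sol_ider k m i : ider k (sol m i) = sol (ider k m) i.
Proof.
rewrite /sol -bcoord_ider ider_pure cauchy_l0 ?ider0n // => -[|p] q //= _.
by rewrite ider1 pure0l.
Qed.

Lemma sol_dual m i : sol m i = \sum_l f l m *: sol (v l) i.
Proof.
rewrite {1}[m]fv; have sol0 : sol 0 i = 0 by rewrite -(scale0r 0) solZ scale0r.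
rewrite (big_morph (sol^~ i) (fun x y => solD x y i) sol0).
by apply: eq_bigr => l _; rewrite solZ.
Qed.

Lemma sol_dsol l m : \sum_i sol m i * dsol l i = (f l m)%:A.
Proof.
rewrite -[RHS]form_ext_pure // [X in form_ext _ X]bcoordP form_ext_sum //.
by apply: eq_bigr => i _; rewrite form_extZ.
Qed.

Lemma dsol_dual l j : \sum_k f l (v k) *: dsol k j = dsol l j.
Proof.
rewrite {2}/dsol [X in form_ext (f l) X](bchange_dual_basis f_lin fv) form_ext_sum //.
by apply: eq_bigr => k _; rewrite form_ext_pure.
Qed.

(** The transition matrices between the two bases of (R (x)_S R) (x)_S M that [e] induces through
    the two factors: [gal_mx] writes the right basis in terms of the left one, [gal_inv_mx] the left
    in terms of the right. *)
Definition gal_mx i j : tens_sq R := \sum_l tpure (sol (v l) i) (dsol l j).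
Definition gal_inv_mx i j : tens_sq R := \sum_l tpure (dsol l i) (sol (v l) j).

(** A balanced [F] compatible with theta induces an additive map from R (x)_S M to R (x)_S R
    commuting with theta, and the sum is the image of the constant [e j]. *)
Lemma lift_basis_const (F : R -> M -> tens_sq R) j : balanced_map F ->
  (forall k r m, ider k (F r m) = cauchy k (fun p q => F (ider p r) (ider q m))) ->
  is_const (\sum_l F (dsol l j) (v l)).
Proof.
move=> bal Fi; have F0 : tens_lift F 0 = 0.
  by apply: (addIr (tens_lift F 0)); rewrite -tens_liftD // !add0r.
have liftF_ider k z : tens_lift F (ider k z) = ider k (tens_lift F z).
  elim/tens_ind: z => [r m|x y IHx IHy]; last first.
    by rewrite iderD !tens_liftD // IHx IHy iderD.
  rewrite ider_pure (tens_lift_pure bal) Fi /cauchy (big_morph _ (tens_liftD bal) F0).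
  by apply: eq_bigr => p _; rewrite (tens_lift_pure bal).
have -> : \sum_l F (dsol l j) (v l) = tens_lift F (e j).
  rewrite [X in tens_lift _ X](bchange_dual_basis f_lin fv).
  rewrite (big_morph _ (tens_liftD bal) F0).
  by apply: eq_bigr => l _; rewrite (tens_lift_pure bal).
by move=> k; rewrite -liftF_ider e_const; case: eqP.
Qed.

Lemma gal_mx_const i j : is_const (gal_mx i j).
Proof.
apply: (lift_basis_const (F := fun r m => tpure (sol m i) r : tens_sq R)).
  split=> [m r r'|r m m'|a r m]; rewrite /tpure; first by rewrite pureDr.
    by rewrite solD pureDl.
  by rewrite solZ pureZ.
move=> k r m; rewrite [LHS]ider_tpure cauchyC.
by apply: eq_cauchy => p q _; rewrite sol_ider.
Qed.

Lemma gal_inv_mx_const i j : is_const (gal_inv_mx i j).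
Proof.
apply: (lift_basis_const (F := fun r m => tpure r (sol m j) : tens_sq R)).
  split=> [m r r'|r m m'|a r m]; rewrite /tpure; first by rewrite pureDl.
    by rewrite solD pureDr.
  by rewrite solZ pureZ.
move=> k r m; rewrite [LHS]ider_tpure.
by apply: eq_cauchy => p q _; rewrite sol_ider.
Qed.

(** Summing over [i] first contracts the left factors to the scalar [f l m] of [S]; it then crosses
    the tensor sign and the dual basis reassembles [sol m j]. The next three identities follow the
    same pattern. *)
Lemma iotar_sol m j : iotar (sol m j) = \sum_i iotal (sol m i) * gal_inv_mx i j.
Proof.
under eq_bigr do rewrite mulr_sumr.
rewrite exchange_big sol_dual rmorph_sum; apply: eq_bigr => l _.
under eq_bigr do rewrite -iota_tpure mulrA -rmorphM.
by rewrite -mulr_suml -rmorph_sum sol_dsol; exact: iotarZ.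
Qed.

Lemma iotar_dsol l j : iotar (dsol l j) = \sum_i iotal (dsol l i) * gal_mx i j.
Proof.
under eq_bigr do rewrite mulr_sumr.
rewrite exchange_big -dsol_dual rmorph_sum; apply: eq_bigr => k _.
under eq_bigr do rewrite -iota_tpure mulrA -rmorphM (mulrC (dsol _ _)).
by rewrite -mulr_suml -rmorph_sum sol_dsol; exact: iotarZ.
Qed.

Lemma iotal_sol m j : iotal (sol m j) = \sum_i iotar (sol m i) * gal_mx j i.
Proof.
under eq_bigr do rewrite mulr_sumr.
rewrite exchange_big sol_dual rmorph_sum; apply: eq_bigr => l _.
under eq_bigr do rewrite -iota_tpure mulrCA -rmorphM.
by rewrite -mulr_sumr -rmorph_sum sol_dsol; exact: iotalZ.
Qed.

Lemma iotal_dsol l j : iotal (dsol l j) = \sum_i iotar (dsol l i) * gal_inv_mx j i.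
Proof.
under eq_bigr do rewrite mulr_sumr.
rewrite exchange_big -dsol_dual rmorph_sum; apply: eq_bigr => k _.
under eq_bigr do rewrite -iota_tpure mulrCA -rmorphM (mulrC (dsol _ _)).
by rewrite -mulr_sumr -rmorph_sum sol_dsol; exact: iotalZ.
Qed.
End FundamentalMatrix.

(** * ID-simplicity of the fundamental subalgebra *)

Lemma is_const0 (V : iterZmodType) : is_const (0 : V).
Proof. by move=> k; rewrite ider_0 if_same. Qed.

Lemma is_const1 (Q : idPzRingType) : is_const (1 : Q).
Proof. by move=> k; rewrite ider1; case: k. Qed.

Lemma is_constB (V : iterZmodType) (x y : V) : is_const x -> is_const y -> is_const (x - y).
Proof. by move=> cx cy n; rewrite iderD iderN cx cy; case: eqP => // _; rewrite subrr. Qed.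

Lemma is_constM (R : idPzRingType) (x y : R) : is_const x -> is_const y -> is_const (x * y).
Proof.
move=> /idconstP cx /idconstP cy; apply/idconstP.
by have [_ _] := idconst_subring R; apply.
Qed.

Lemma is_const_image (V W : iterZmodType) (g : V -> W) x : g 0 = 0 ->
  commutes_ider g -> is_const x -> is_const (g x).
Proof. by move=> g0 gi cx n; rewrite -gi cx; case: eqP. Qed.

Section FundamentalSubring.
Variables (S : idRingType) (R : idAlgType S) (M : idModType S).
Hypotheses (simpleS : idsimple S) (simpleR : idsimple R).
Hypothesis constR : forall r : R, is_const r <-> exists2 c : S, is_const c & r = c%:A.
Variables (n : nat) (e : 'I_n -> bchange R M).
Hypothesis e_const : forall i, is_const (e i).
Hypothesis e_basis :
  forall z : bchange R M, exists! c : {ffun 'I_n -> R}, z = \sum_i c i *: e i.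
Variables (N : nat) (f : 'I_N -> M -> S) (v : 'I_N -> M).
Hypotheses (f_lin : forall l, linear_form (f l)) (fv : forall m, m = \sum_l f l m *: v l).

Local Notation X := (sol e_basis).
Local Notation Y := (dsol e f).
Local Notation g := (gal_mx e_basis f v).
Local Notation h := (gal_inv_mx e_basis f v).

Inductive fund_mem : R -> Prop :=
| fund_alg s : fund_mem s%:A
| fund_sol l i : fund_mem (X (v l) i)
| fund_dsol l i : fund_mem (Y l i)
| fundB x y : fund_mem x -> fund_mem y -> fund_mem (x - y)
| fundM x y : fund_mem x -> fund_mem y -> fund_mem (x * y)
| fund_ider k x : fund_mem x -> fund_mem (ider k x).

Definition fund_subalg : idsubalg R := IDSubalg fund_alg fundB fundM fund_ider.
Local Notation R' := (isub_idAlg fund_subalg).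

Inductive gal_mem : tens_sq R -> Prop :=
| gal_alg c : is_const c -> gal_mem (iotal (c%:A : R))
| gal_coef i j : gal_mem (g i j)
| gal_inv_coef i j : gal_mem (h i j)
| galB x y : gal_mem x -> gal_mem y -> gal_mem (x - y)
| galM x y : gal_mem x -> gal_mem y -> gal_mem (x * y).

Lemma gal_mem_const a : gal_mem a -> is_const a.
Proof.
elim=> {a} [c cc|i j|i j|x y _ cx _ cy|x y _ cx _ cy].
- apply: is_const_image; [exact: rmorph0 | exact: iotal_ider|].
  by apply/constR; exists c.
- exact: gal_mx_const.
- exact: gal_inv_mx_const.
- exact: is_constB.
- exact: is_constM.
Qed.

Lemma gal_mem0 : gal_mem 0.
Proof. by rewrite -(rmorph0 (@iotal S R)) -(scale0r (1 : R)); apply/gal_alg/is_const0. Qed.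

Lemma gal_mem1 : gal_mem 1.
Proof. by rewrite -(rmorph1 (@iotal S R)) -(scale1r (1 : R)); apply/gal_alg/is_const1. Qed.

Lemma galD x y : gal_mem x -> gal_mem y -> gal_mem (x + y).
Proof.
move=> Ax Ay; rewrite -[y]opprK -(sub0r y); apply: galB => //.
exact/galB/Ay/gal_mem0.
Qed.

Lemma gal_submodl : const_submod (@iotal S R) gal_mem.
Proof.
split; [exact: gal_mem_const|exact: gal_mem0|exact: galD|] => r a /constR[c cc ->] Aa.
exact/galM/Aa/gal_alg.
Qed.

Lemma gal_submodr : const_submod (@iotar S R) gal_mem.
Proof.
split; [exact: gal_mem_const|exact: gal_mem0|exact: galD|] => r a /constR[c cc ->] Aa.
rewrite [X in X * _](_ : _ = iotal (c%:A : R)); first exact/galM/Aa/gal_alg.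
exact: iotar_alg.
Qed.

Lemma fundN x : fund_mem x -> fund_mem (- x).
Proof.
by move=> Bx; rewrite -sub0r -(scale0r (1 : R)); apply: fundB Bx; exact: fund_alg.
Qed.

Lemma fundD x y : fund_mem x -> fund_mem y -> fund_mem (x + y).
Proof. by move=> Bx By; rewrite -[y]opprK; apply: fundB => //; exact: fundN. Qed.

(** The transition formulas settle the generators, and the span is a subring stable under derivation
    since its vectors are constant. *)
Lemma fund_spanr r : fund_mem r -> lin_span (@iotal S R) fund_mem gal_mem (iotar r).
Proof.
elim=> {r} [s|l i|l i|x y _ IHx _ IHy|x y _ IHx _ IHy|k x _ IHx].
- by rewrite iotar_alg -[iotal _]mulr1; apply: lin_span1; [exact: fund_alg|exact: gal_mem1].
- rewrite (iotar_sol e_basis f_lin fv); apply: lin_span_sum => j //; apply: lin_span1.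
    exact: fund_sol.
  exact: gal_inv_coef.
- rewrite (iotar_dsol e_basis f_lin fv); apply: lin_span_sum => j //; apply: lin_span1.
    exact: fund_dsol.
  exact: gal_coef.
- by rewrite rmorphB; apply: lin_spanD => //; exact: lin_spanN fundN _.
- rewrite rmorphM; apply: lin_spanM => //; [exact: fundM | exact: galM].
- rewrite iotar_ider; apply: lin_span_ider => //; first exact: iotal_ider.
    exact: fund_ider.
  exact: gal_mem_const.
Qed.

Lemma fund_spanl r : fund_mem r -> lin_span (@iotar S R) fund_mem gal_mem (iotal r).
Proof.
elim=> {r} [s|l i|l i|x y _ IHx _ IHy|x y _ IHx _ IHy|k x _ IHx].
- rewrite -iotar_alg -[iotar _]mulr1.
  by apply: lin_span1; [exact: fund_alg|exact: gal_mem1].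
- rewrite (iotal_sol e_basis f_lin fv); apply: lin_span_sum => j //; apply: lin_span1.
    exact: fund_sol.
  exact: gal_coef.
- rewrite (iotal_dsol e_basis f_lin fv); apply: lin_span_sum => j //; apply: lin_span1.
    exact: fund_dsol.
  exact: gal_inv_coef.
- by rewrite rmorphB; apply: lin_spanD => //; exact: lin_spanN fundN _.
- rewrite rmorphM; apply: lin_spanM => //; [exact: fundM | exact: galM].
- rewrite iotal_ider; apply: lin_span_ider => //; first exact: iotar_ider.
    exact: fund_ider.
  exact: gal_mem_const.
Qed.

Lemma fund_mem_sol m i : fund_mem (X m i).
Proof.
rewrite (sol_dual _ fv); elim/big_ind: _ => [|x y|].
- by rewrite -(scale0r (1 : R)); exact: fund_alg.
- exact: fundD.
move=> l _; rewrite -mulr_algl; apply: fundM; [exact: fund_alg | exact: fund_sol].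
Qed.

Lemma fund_ival (r : R') : fund_mem (ival r).
Proof. exact: (ival_mem r). Qed.

Lemma fund_simple : idsimple R'.
Proof.
move=> I I0 ID IM Ii.
case: (pselect (exists2 j, j != 0 & I j)) => [[j nz_j Ij]|nj]; [right|left]; last first.
  by move=> x Ix; apply: contrapT => /eqP nz_x; apply: nj; exists x.
pose IR (a : tens_sq R) := exists2 j : R', I j & a = iotar (ival j).
pose J := lin_span (@iotal S R) (fun=> True) IR.
have JD x y : J x -> J y -> J (x + y) by exact: lin_spanD.
have JZ r x : J x -> J (iotal r * x).
  elim=> [|s a z _ Ia _ IHz]; first by rewrite mulr0; exact: lin_span0.
  by rewrite mulrDr mulrA -rmorphM; exact: lin_spanDl.
have JN x : J x -> J (- x) by apply: lin_spanN.
have JMr b x : fund_mem b -> J x -> J (iotar b * x).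
  move=> Bb; elim=> [|s a z _ [k Ik ->] _ IHz]; first by rewrite mulr0; exact: lin_span0.
  rewrite mulrDr mulrCA; apply: lin_spanDl => //.
  have Bb' : b \in isub_pred fund_subalg by apply/isub_predP.
  exists (ISub Bb' * k); first exact: IM.
  by rewrite rmorphM.
have Ji k x : J x -> J (ider k x).
  elim=> [|s a z _ [i Ii' ->] _ IHz]; first by rewrite ider_0; exact: lin_span0.
  rewrite iderD iderM /cauchy; apply: (JD) => //; elim/big_ind: _ => //; first exact: lin_span0.
  move=> p _; rewrite -iotal_ider -iotar_ider; apply: lin_span1 => //.
  by exists (ider (k - p)%N i) => //; exact: Ii.
(* Each entry of [g] and [h] is a sum of tensors with right factor in the fundamental subalgebra,
   and [J] absorbs [R] on the left and that subalgebra on the right. *)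
have JA a x : gal_mem a -> J x -> J (a * x).
  move=> Aa; elim: Aa x => {a} [c _|i k|i k|a b _ IHa _ IHb|a b _ IHa _ IHb] x Jx.
  - exact: JZ.
  - rewrite mulr_suml; elim/big_ind: _ => //; first exact: lin_span0.
    by move=> l _; rewrite -iota_tpure -mulrA; apply/JZ/JMr => //; exact: fund_dsol.
  - rewrite mulr_suml; elim/big_ind: _ => //; first exact: lin_span0.
    by move=> l _; rewrite -iota_tpure -mulrA; apply/JZ/JMr => //; exact: fund_sol.
  - by rewrite mulrBl; apply/JD/JN/IHb => //; exact: IHa.
  - by rewrite -mulrA; apply/IHa/IHb.
have Jj : J (iotar (ival j)).
  rewrite -[iotar _]mul1r -(rmorph1 (@iotal S R)).
  by apply: lin_span1 => //; exists j.
(* The coefficients must stay in [fund_mem], as only such elements can be moved to the other factor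
   by [fund_spanl]. *)
have spanl : lin_span (@iotal S R) fund_mem (fun a => gal_mem a /\ J a) (iotar (ival j)).
  apply: lin_span_sub => //.
  - exact: iotal_ider.
  - exact: gal_submodl.
  - move=> x y c Bx By /constR[d _ ->]; apply: fundB => //; apply: fundM => //.
    exact: fund_alg.
  - by apply: fund_spanr; exact: fund_ival.
(* Each coefficient [iotal r] is replaced by its expansion over the right factor; the constants that
   appear multiply [a] without leaving [J]. The factor [1] is the constant to be isolated by
   [lin_span_const]. *)
have spanr : lin_span (@iotar S R) (fun=> True) (fun a => gal_mem a /\ J a)
    (iotar (ival j) * 1).
  rewrite mulr1; elim: spanl => [|r a z Br [Aa Ja] _ IHz]; first exact: lin_span0.
  apply: lin_spanD => // {IHz}.
  suff span_mul w : lin_span (@iotar S R) fund_mem gal_mem w ->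
      lin_span (@iotar S R) (fun=> True) (fun a => gal_mem a /\ J a) (w * a).
    exact/span_mul/fund_spanl.
  elim=> [|s b y Bs Ab _ IHy].
    by rewrite mul0r; exact: lin_span0.
  rewrite mulrDl; apply: lin_spanD => //; rewrite -mulrA; apply: lin_span1 => //.
  by split; [exact: galM | exact: JA].
have [_ J1] : gal_mem 1 /\ J 1.
  apply: (lin_span_const _ simpleR _ _ _ spanr).
  - exact: iotar_ider.
  - split=> [a [/gal_mem_const]||a b [Aa Ja] [Ab Jb]|c a cc [Aa Ja]] //.
    + by split; [exact: gal_mem0 | exact: lin_span0].
    + by split; [exact: galD | exact: JD].
    + have [_ _ _ galZ] := gal_submodr; split; first exact: galZ.
      have /constR[d _ ->] := cc; apply: JMr => //; exact: fund_alg.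
  - by apply: contra_neq nz_j => j0; apply: val_inj.
  - exact: is_const1.
have [L LI L1] : exists2 L : seq (R * R), (forall p, List.In p L ->
    exists2 k : R', I k & p.2 = ival k) & pure 1 1 = \sum_(p <- L) pure p.1 p.2.
  rewrite -[pure 1 1]/(1 : tens_sq R); elim: J1 => [|r a z _ [k Ik ->] _ [L LI ->]].
    by exists [::] => //; rewrite big_nil.
  exists ((r, ival k) :: L) => [p [<-|/LI //]|]; first by exists k.
  by rewrite big_cons iota_tpure.
(* Applied to the left factor 1, which is torsion-free over [S]: a nonzero [a] of [S] becomes an
   [S]-combination of elements of [I]. *)
have [a nz_a [b ab]] := pure_torsion (idsimple_domain simpleS)
  (fun a => @alg_eq0 _ simpleS R a) L1.
have Ia : I (a%:A : R').
  have [k Ik ak] : exists2 k, I k & a%:A = ival k.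
    rewrite ab; elim: L LI {ab L1} => [|p L IHL] LI.
      by exists 0 => //; rewrite big_nil.
    have [|k1 Ik1 k1E] := IHL; first by move=> q qL; apply: LI; right.
    have [|k2 Ik2 p2] := LI p; first by left.
    exists ((b p.1)%:A * k2 + k1); first by apply: ID => //; exact: IM.
    by rewrite big_cons k1E p2 mulr_algl.
  by rewrite [_%:A](_ : _ = k) //; apply: val_inj.
(* The preimage of [I] in [S] is a nonzero ID-ideal. *)
have I1 : I (1 : S)%:A.
  apply: (idsimple_ideal1 simpleS (I := fun s => I (s%:A : R')) _ _ _ _ nz_a Ia).
  - by rewrite scale0r.
  - by move=> x y Ix Iy; rewrite scalerDl; exact: ID.
  - by move=> s x Ix; rewrite -scalerA -mulr_algl; exact: IM.
  - by move=> k x Ix; rewrite -ider_alg; exact: Ii.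
by move=> x; rewrite -[x]mulr1 -(scale1r (1 : R')); exact: IM.
Qed.

Definition bchange_val (z : bchange R' M) : bchange R M :=
  tens_lift (fun (r : R') m => pure (ival r) m) z.

Lemma bchange_val_bal : balanced_map (fun (r : R') (m : M) => pure (ival r) m : tens R M).
Proof.
split=> [m r r'|r m m'|a r m]; first by rewrite -pureDl.
  by rewrite pureDr.
by rewrite -pureZ.
Qed.

Lemma bchange_val_pure (r : R') m : bchange_val (pure r m) = pure (ival r) m.
Proof. exact: (tens_lift_pure bchange_val_bal). Qed.

Lemma bchange_valD : {morph bchange_val : x y / x + y}.
Proof. exact: (tens_liftD bchange_val_bal). Qed.

Lemma bchange_val0 : bchange_val 0 = 0.
Proof. by apply: (addIr (bchange_val 0)); rewrite -bchange_valD !add0r. Qed.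

Lemma bchange_val_sum (T : Type) (s : seq T) (F : T -> bchange R' M) :
  bchange_val (\sum_(i <- s) F i) = \sum_(i <- s) bchange_val (F i).
Proof. exact: (big_morph _ bchange_valD bchange_val0). Qed.

Lemma bchange_valZ (a : R') z : bchange_val (a *: z) = ival a *: bchange_val z.
Proof.
elim/tens_ind: z => [r m|x y IHx IHy]; last by rewrite scalerDr !bchange_valD IHx IHy scalerDr.
by rewrite bchange_scale_pure !bchange_val_pure bchange_scale_pure.
Qed.

Lemma bchange_val_ider : commutes_ider bchange_val.
Proof.
move=> k z; elim/tens_ind: z => [r m|x y IHx IHy].
  rewrite ider_pure bchange_val_sum bchange_val_pure ider_pure.
  by apply: eq_bigr => i _; exact: bchange_val_pure.
by rewrite iderD !bchange_valD IHx IHy iderD.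
Qed.

Lemma form_ext_val l z : form_ext (f l) (bchange_val z) = ival (form_ext (f l) z).
Proof.
elim/tens_ind: z => [r m|x y IHx IHy].
  by rewrite bchange_val_pure !form_ext_pure.
by rewrite bchange_valD !form_extD // IHx IHy.
Qed.

(** This is flatness of the projective module [M] made explicit: the dual basis recovers [z] from
    its coordinates, on which [bchange_val] acts through the injective [ival]. *)
Lemma bchange_val_inj : injective bchange_val.
Proof.
move=> x y xy; rewrite [x](bchange_dual_basis f_lin fv) [y](bchange_dual_basis f_lin fv).
apply: eq_bigr => l _; congr (pure _ _); apply: val_inj.
by rewrite -[LHS]form_ext_val -[RHS]form_ext_val xy.
Qed.

(** The basis [e] descends to R': the [dsol] are its coefficients on [v], and the coordinates on [e]
    of elements defined over R' are combinations of the [sol]. *)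
Lemma fund_solution : solution_ring M R'.
Proof.
split; first exact: fund_simple.
  move=> r; split=> [cr|[c cc ->]]; last first.
    by move=> k; rewrite ider_alg cc; case: eqP => // _; rewrite scale0r.
  have /constR[c cc rc] : is_const (ival r) by apply: is_const_image cr.
  by exists c => //; apply: val_inj.
have Bcoord z i : fund_mem (bcoord e_basis (bchange_val z) i).
  elim/tens_ind: z => [r m|x y IHx IHy]; last first.
    by rewrite bchange_valD bcoordD; exact: fundD.
  rewrite bchange_val_pure bcoord_pure.
  by apply: fundM; [exact: fund_ival | exact: fund_mem_sol].
pose lift r (Br : fund_mem r) : R' :=
  @ISub _ _ fund_subalg r (introT (isub_predP fund_subalg r) Br).
pose e' j : bchange R' M := \sum_l pure (lift _ (fund_dsol l j)) (v l).
have e'E j : bchange_val (e' j) = e j.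
  rewrite bchange_val_sum [RHS](bchange_dual_basis f_lin fv).
  by apply: eq_bigr => l _; rewrite bchange_val_pure.
exists n, e'; split=> [i k|z].
  apply: bchange_val_inj; rewrite bchange_val_ider e'E e_const.
  by case: eqP => _; rewrite ?e'E ?bchange_val0.
exists [ffun i => lift _ (Bcoord z i)]; split=> [|d zd].
  apply: bchange_val_inj; rewrite bchange_val_sum [LHS](bcoordP e_basis).
  by apply: eq_bigr => i _; rewrite bchange_valZ e'E ffunE.
apply/ffunP => i; apply: val_inj; rewrite ffunE /=.
apply/esym; apply: (@bcoord_uniq _ _ _ _ _ e_basis _ (fun i => ival (d i))).
rewrite zd bchange_val_sum; apply: eq_bigr => j _.
by rewrite bchange_valZ e'E.
Qed.

Lemma fund_mem_all : (forall R1 : idAlgType S, solution_ring M R1 ->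
    forall g : {lrmorphism R1 -> R}, commutes_ider g -> bijective g) ->
  forall r, fund_mem r.
Proof.
move=> minR r.
have [k _ kK] := minR _ fund_solution (ival_lrmorphism fund_subalg) (@ival_ider _ _ _).
by rewrite -(kK r); exact: fund_ival.
Qed.
End FundamentalSubring.

(** * Generation of the tensor square by its constants, and finite type *)

Definition const_generated (S : idRingType) (R : idAlgType S) : Prop :=
  (forall r, lin_span (@iotal S R) (fun=> True) (@is_const (tens_sq R)) (iotar r)) /\
  (forall r, lin_span (@iotar S R) (fun=> True) (@is_const (tens_sq R)) (iotal r)).

Lemma PV_torsor (S : idRingType) (R : idAlgType S) : idsimple S -> PV_extension R ->
  [/\ idsimple R, forall r : R, is_const r <-> exists2 c : S, is_const c & r = c%:A,
      const_generated R & finite_type (consts (tens_sq R) : comAlgType (consts S))].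
Proof.
move=> simpleS [M [[simpleR constR [n [e [e_const e_basis]]]] minR]].
have [N [f [v [f_lin fv]]]] := @dual_basis S M simpleS.
have allR := fund_mem_all simpleS simpleR constR e_const e_basis f_lin fv minR.
have galc := gal_mem_const constR e_const f_lin fv.
have spanr r := fund_spanr constR e_const f_lin fv (allR r).
have spanl r := fund_spanl constR e_const f_lin fv (allR r).
split=> //; first by split=> r; [move: (spanr r)|move: (spanl r)];
  apply: lin_span_mono => // a /galc.
pose A := gal_mem e_basis f v.
(* The tensor square is the span over the left factor of the constants in [A], so [lin_span_const]
   with scalar 1 leaves no other constants. *)
have Amem (z : tens_sq R) : is_const z -> A z.
  move=> cz; apply: (lin_span_const (@iotal_ider S R) simpleR
    (gal_submodl constR e_const e_basis f_lin fv) (oner_neq0 R) cz).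
  have span w : lin_span (@iotal S R) (fun=> True) A w.
    elim/tens_ind: w => [r r'|x y]; last exact: lin_spanD.
    rewrite -[pure _ _]iota_tpure.
    elim: (spanr r') => [|s a w _ Aa _ IHw]; first by rewrite mulr0; exact: lin_span0.
    by rewrite mulrDr; apply: lin_spanD => //; rewrite mulrA -rmorphM; exact: lin_span1.
  exact: span.
have gc i j : gal_mx e_basis f v i j \in idconst (tens_sq R).
  by apply/idconstP/galc/gal_coef.
have hc i j : gal_inv_mx e_basis f v i j \in idconst (tens_sq R).
  by apply/idconstP/galc/gal_inv_coef.
exists ([seq Const (gc i j) | i <- enum 'I_n, j <- enum 'I_n] ++
        [seq Const (hc i j) | i <- enum 'I_n, j <- enum 'I_n]).
move=> B [B1 Blin BM] sB.
(* [gal_mem] is a predicate on the tensor square, so the induction bears on the value [a], from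
   which [x] is recovered by injectivity of [cval]. *)
suff memB a : A a -> forall x : consts (tens_sq R), cval x = a -> x \in B.
  by move=> x; apply: (memB _ _ x erefl); apply/Amem/idconstP/cvalP.
have B0 : 0 \in B by have := Blin (-1) _ _ B1 B1; rewrite scaleN1r addNr.
elim=> {a} [c cc|i j|i j|a b Aa IHa Ab IHb|a b Aa IHa Ab IHb] x xE.
- have cP : c \in idconst S by apply/idconstP.
  have -> : x = (Const cP) *: (1 : consts (tens_sq R)) + 0.
    by apply: val_inj; rewrite addr0 /= xE -[RHS]/(iotal _ * 1) mulr1.
  exact: Blin.
- have -> : x = Const (gc i j) by apply: val_inj.
  by apply: sB; rewrite mem_cat; apply/orP; left; apply: allpairs_f; rewrite mem_enum.
- have -> : x = Const (hc i j) by apply: val_inj.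
  by apply: sB; rewrite mem_cat; apply/orP; right; apply: allpairs_f; rewrite mem_enum.
- have ac : a \in idconst (tens_sq R) by apply/idconstP/galc.
  have bc : b \in idconst (tens_sq R) by apply/idconstP/galc.
  have -> : x = -1 *: Const bc + Const ac.
    by rewrite scaleN1r addrC; apply: val_inj.
  by apply: Blin; [exact: IHb | exact: IHa].
- have ac : a \in idconst (tens_sq R) by apply/idconstP/galc.
  have bc : b \in idconst (tens_sq R) by apply/idconstP/galc.
  have -> : x = Const ac * Const bc by apply: val_inj.
  by apply: BM; [exact: IHa | exact: IHb].
Qed.

(** * Points of the constants of the tensor square *)

Lemma cval_sum (Q : idPzRingType) (I : Type) (s : seq I) (F : I -> consts Q) :
  cval (\sum_(i <- s) F i) = \sum_(i <- s) cval (F i).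
Proof. by elim: s => [|i s IHs]; rewrite ?big_nil // !big_cons -IHs. Qed.

Section Representability.
Variables (S : idRingType) (R : idAlgType S).
Hypotheses (simpleS : idsimple S) (simpleR : idsimple R).
Hypothesis constR : forall r : R, is_const r <-> exists2 c : S, is_const c & r = c%:A.
Hypothesis genR : const_generated R.
Local Notation C := (consts S).
Local Notation A := (consts (tens_sq R)).

Section ScalarExt.
Variable D : comAlgType C.
Local Notation T := (scalar_ext R D).
Implicit Types (r : R) (d : D) (t : T).

Definition ext_inl (r : R) : T := epure (r : overC R) (1 : trivID D).
Definition ext_inr (d : D) : T := epure (1 : overC R) (d : trivID D).

Fact ext_inl_zmod : zmod_morphism ext_inl.
Proof.
move=> r s; apply: (addIr (ext_inl s)); rewrite subrK.
by rewrite /ext_inl -[X in X = _]pureDl subrK.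
Qed.
Fact ext_inl_monoid : monoid_morphism ext_inl.
Proof. by split=> // r s; rewrite /ext_inl epureM mulr1. Qed.
HB.instance Definition _ := GRing.isZmodMorphism.Build R T ext_inl ext_inl_zmod.
HB.instance Definition _ := GRing.isMonoidMorphism.Build R T ext_inl ext_inl_monoid.

Fact ext_inr_zmod : zmod_morphism ext_inr.
Proof.
move=> r s; apply: (addIr (ext_inr s)); rewrite subrK.
by rewrite /ext_inr -[X in X = _]pureDr subrK.
Qed.
Fact ext_inr_monoid : monoid_morphism ext_inr.
Proof. by split=> // r s; rewrite /ext_inr epureM mulr1. Qed.
HB.instance Definition _ := GRing.isZmodMorphism.Build D T ext_inr ext_inr_zmod.
HB.instance Definition _ := GRing.isMonoidMorphism.Build D T ext_inr ext_inr_monoid.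

Lemma ext_inlr r d : epure (r : overC R) (d : trivID D) = ext_inl r * ext_inr d :> T.
Proof. by rewrite epureM mulr1 mul1r. Qed.

Lemma ext_inl_ider : commutes_ider ext_inl.
Proof.
move=> n r; rewrite [RHS]ider_tpure cauchyC cauchy_l0 ?ider0n // => -[|i] j //= _.
by rewrite ider1 /tpure pure0r.
Qed.

Lemma ext_inr_const d : is_const (ext_inr d).
Proof.
move=> n; rewrite [LHS]ider_tpure cauchy0; first by case: n; rewrite //= ider0n.
by move=> [|i] [|j] //= _; rewrite ?ider1 ?pure0l /tpure ?pure0r ?pure0l.
Qed.

Lemma ext_inlZ (c : C) d : ext_inl (cval c)%:A * ext_inr d = ext_inr (c *: d).
Proof. by rewrite -ext_inlr /epure /tpure -[RHS]pureZ. Qed.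

Lemma ext_inr_submod : const_submod ext_inl (fun t => exists d, t = ext_inr d).
Proof.
split=> [_ [d ->]||_ _ [d ->] [d' ->]|r _ /constR[c cc ->] [d ->]].
- exact: ext_inr_const.
- by exists 0; rewrite rmorph0.
- by exists (d + d'); rewrite rmorphD.
- have cP : c \in idconst S by apply/idconstP.
  by exists (Const cP *: d); rewrite -ext_inlZ.
Qed.

Lemma ext_span t : lin_span ext_inl (fun=> True) (fun t => exists d, t = ext_inr d) t.
Proof.
elim/tens_ind: t => [r d|x y]; last exact: lin_spanD.
rewrite -[pure _ _]/(epure _ _) ext_inlr; apply: lin_span1 => //; by exists d.
Qed.

Lemma ext_const t : is_const t -> exists d, t = ext_inr d.
Proof.
move=> ct; apply: (lin_span_const ext_inl_ider simpleR ext_inr_submod (oner_neq0 R) ct).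
exact: ext_span.
Qed.

(** [pure_torsion] over the field of constants, with an empty sum, gives a nonzero [c] with
    [c *: d = 0], and [c] is invertible. *)
Lemma ext_inr_eq0 d : ext_inr d = 0 -> d = 0.
Proof.
move=> d0.
have domC (a b : C) : a * b = 0 -> a = 0 \/ b = 0.
  move=> /(congr1 (@cval S))/(idsimple_domain simpleS)[a0|b0]; [left|right];
  exact: val_inj.
have free (c : C) : c *: (1 : overC R) = 0 -> c = 0.
  by move=> c0; apply: val_inj; apply: (alg_eq0 simpleS (A := R)).
have [|c nz_c [b]] := @pure_torsion _ domC (overC R) (trivID D) 1 d [::] free.
  by rewrite big_nil.
rewrite big_nil => cd0.
have [c' cc' c'c] := idsimple_const_inv simpleS (elimT (idconstP _) (cvalP c)) nz_c.
have cP : c' \in idconst S by apply/idconstP.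
rewrite -[d]scale1r; have -> : 1 = Const cP * c by apply: val_inj; rewrite /= c'c.
by rewrite -scalerA [c *: d]cd0 scaler0.
Qed.

Lemma ext_inr_inj : injective ext_inr.
Proof.
by move=> d d' /eqP; rewrite -subr_eq0 -rmorphB => /eqP/ext_inr_eq0/eqP; rewrite subr_eq0 => /eqP.
Qed.

Section Endomorphism.
Variable F : {rmorphism T -> T}.
Hypotheses (F_ider : commutes_ider F).
Hypothesis F_scal : forall (s : S) d x,
  F (ext_inl s%:A * ext_inr d * x) = ext_inl s%:A * ext_inr d * F x.

Lemma endo_alg s : F (ext_inl s%:A) = ext_inl s%:A.
Proof.
by have := F_scal s 1 1; rewrite !rmorph1 !mulr1.
Qed.

Lemma endo_inr d : F (ext_inr d) = ext_inr d.
Proof.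
by have := F_scal 1 d 1; rewrite scale1r !rmorph1 !mulr1 !mul1r.
Qed.

Let lin_bal : balanced_map (fun r r' : R => ext_inl r * F (ext_inl r')).
Proof.
split=> [r s s'|r s s'|k r s]; first by rewrite rmorphD mulrDl.
  by rewrite !rmorphD mulrDr.
by rewrite -[k *: r]mulr_algl -[k *: s]mulr_algl !rmorphM endo_alg mulrCA mulrA.
Qed.

(* The R-linear extension R (x)_S R -> R (x)_C D of F restricted to R. *)
Definition endo_ext (z : tens_sq R) : T :=
  tens_lift (fun r r' : R => ext_inl r * F (ext_inl r')) z.

Lemma endo_ext_pure r r' : endo_ext (iotal r * iotar r') = ext_inl r * F (ext_inl r').
Proof. by rewrite iota_tpure; exact: (tens_lift_pure lin_bal). Qed.

Lemma endo_extD : {morph endo_ext : x y / x + y}.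
Proof. exact: (tens_liftD lin_bal). Qed.

Lemma endo_ext0 : endo_ext 0 = 0.
Proof. by apply: (addIr (endo_ext 0)); rewrite -endo_extD !add0r. Qed.

Lemma endo_extM : {morph endo_ext : x y / x * y}.
Proof.
move=> x y; elim/tens_ind: x => [r s|x x' IHx IHx']; last first.
  by rewrite mulrDl !endo_extD IHx IHx' mulrDl.
elim/tens_ind: y => [r' s'|y y' IHy IHy']; last first.
  by rewrite mulrDr !endo_extD IHy IHy' mulrDr.
rewrite -![pure _ _]iota_tpure mulrACA -!rmorphM !endo_ext_pure.
by rewrite !rmorphM mulrACA.
Qed.

Lemma endo_ext_inl r : endo_ext (iotal r) = ext_inl r.
Proof. by rewrite -[iotal r]mulr1 -(rmorph1 (@iotar S R)) endo_ext_pure !rmorph1 mulr1. Qed.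

Lemma endo_ext_inr r : endo_ext (iotar r) = F (ext_inl r).
Proof. by rewrite -[iotar r]mul1r -(rmorph1 (@iotal S R)) endo_ext_pure !rmorph1 mul1r. Qed.

Lemma endo_ext_ider : commutes_ider endo_ext.
Proof.
move=> n z; elim/tens_ind: z => [r s|x y IHx IHy]; last first.
  by rewrite iderD !endo_extD IHx IHy iderD.
rewrite -[pure _ _]iota_tpure iderM endo_ext_pure iderM.
rewrite /cauchy (big_morph _ endo_extD endo_ext0); apply: eq_bigr => i _.
by rewrite -iotal_ider -iotar_ider endo_ext_pure -ext_inl_ider -F_ider -ext_inl_ider.
Qed.

Lemma endo_ext_const (a : A) : exists d, endo_ext (cval a) = ext_inr d.
Proof.
apply: ext_const; apply: is_const_image; [exact: endo_ext0 | exact: endo_ext_ider|].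
exact/idconstP/cvalP.
Qed.

(** The kernel is an ID-submodule of R (x)_C D, so it is spanned by the elements of [D] that it
    contains; but [F] fixes [D]. *)
Lemma endo_inj : injective F.
Proof.
have kerF t : F t = 0 -> t = 0.
  move=> Ft0.
  have : lin_span ext_inl (fun=> True)
      (fun t => (exists d, t = ext_inr d) /\ F t = 0) t.
    apply: lin_span_sub => //.
    - exact: ext_inl_ider.
    - exact: ext_inr_submod.
    - by move=> x y Fx Fy; rewrite rmorphD Fx Fy addr0.
    - by move=> s x Fx; rewrite rmorphM Fx mulr0.
    - by move=> n x Fx; rewrite F_ider Fx ider_0.
    - exact: ext_span.
  elim=> // r a z _ [[d ->]]; rewrite endo_inr => -> _ ->.
  by rewrite mulr0 addr0.
move=> x y /eqP; rewrite -subr_eq0 -rmorphB => /eqP/kerF/eqP.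
by rewrite subr_eq0 => /eqP.
Qed.

(** Write r (x) 1 in R (x)_S R as a sum of (1 (x) s) a with [a] constant. The map [endo_ext] sends
    [iotal r] to [ext_inl r], and each term to [F (ext_inl s)] times an element of [D], which [F]
    fixes; so [ext_inl r] is a value of [F]. *)
Lemma endo_surj t : exists u, F u = t.
Proof.
elim/tens_ind: t => [r d|x y [u Fu] [w Fw]]; last by exists (u + w); rewrite rmorphD Fu Fw.
rewrite -[pure _ _]/(epure _ _) ext_inlr.
suff [u Fu] : exists u, F u = endo_ext (@iotal S R r).
  by exists (u * ext_inr d); rewrite rmorphM endo_inr Fu endo_ext_inl.
elim: (genR.2 (r : R)) => [|s a z _ ca _ [u Fu]]; first by exists 0; rewrite rmorph0 endo_ext0.
have aP : a \in idconst (tens_sq R) by apply/idconstP.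
have [d' ad] := endo_ext_const (Const aP).
exists (ext_inl s * ext_inr d' + u).
by rewrite rmorphD rmorphM Fu endo_inr endo_extD endo_extM endo_ext_inr -ad.
Qed.

Lemma endo_bij : bijective F.
Proof.
have [G FG] := choice endo_surj.
by exists G => // x; apply: endo_inj; rewrite FG.
Qed.
End Endomorphism.

Section PointToEndo.
Variable x : {lrmorphism A -> D}.

Lemma tens_sq_repr (z : tens_sq R) :
  exists L : seq (R * A), z = \sum_(p <- L) iotal p.1 * cval p.2.
Proof.
elim/tens_ind: z => [r r'|y z [L ->] [L' ->]]; last by exists (L ++ L'); rewrite big_cat.
rewrite -[pure _ _]iota_tpure.
elim: (genR.1 r') => [|s a z _ ca _ [L zL]]; first by exists [::]; rewrite big_nil mulr0.
have aP : a \in idconst (tens_sq R) by apply/idconstP.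
exists ((r * s, Const aP) :: L); rewrite big_cons -zL mulrDr mulrA /=.
by rewrite rmorphM.
Qed.

Definition point_sum (L : seq (R * A)) : T := \sum_(p <- L) ext_inl p.1 * ext_inr (x p.2).

(** Well-definedness of the extension, that is, injectivity of R (x)_C A -> R (x)_S R: the relation
    is an [R]-combination of relations with coefficients in [C], which the [C]-linear [x]
    preserves. *)
Lemma point_sum_eq0 (L : seq (R * A)) :
  \sum_(p <- L) iotal p.1 * cval p.2 = 0 -> point_sum L = 0.
Proof.
rewrite /point_sum [X in X = _ -> _]big_tnth [X in _ -> X = _]big_tnth; set m := size L.
pose r (i : 'I_m) := (tnth (in_tuple L) i).1; pose a (i : 'I_m) := (tnth (in_tuple L) i).2.
move=> L0; have ca i : is_const (cval (a i)) by exact/idconstP/cvalP.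
have [|||||L' [L'P rL']] := const_relations (@iotal_ider S R) simpleR
  (P := fun=> True) (J := eq^~ 0) (r := r) _ _ _ _ _ ca L0 => //.
- by move=> y z -> ->; rewrite addr0.
- by move=> s z ->; rewrite mulr0.
- by move=> k z ->; rewrite ider_0.
transitivity (\sum_(t <- L') ext_inl t.1 * \sum_i ext_inl (t.2 i) * ext_inr (x (a i))).
  rewrite -/m; under [LHS]eq_bigr => i _ do rewrite -/(r i) -/(a i) rL' rmorph_sum mulr_suml.
  rewrite exchange_big; apply: eq_bigr => t _; rewrite mulr_sumr; apply: eq_bigr => i _.
  by rewrite rmorphM mulrA.
elim: L' L'P {rL'} => [|t L' IHL] L'P; first by rewrite big_nil.
rewrite big_cons IHL ?addr0 => [|s sL]; last by apply: L'P; right.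
have [|_ ta0 ct] := L'P t; first by left.
have ctC i : exists c : C, t.2 i = (cval c)%:A.
  have /constR[c cc ->] := ct i.
  have cP : c \in idconst S by apply/idconstP.
  by exists (Const cP).
have [c tc] := choice ctC.
rewrite (_ : \sum_i _ = ext_inr (x (\sum_i c i *: a i))); last first.
  rewrite !raddf_sum; apply: eq_bigr => i _.
  rewrite tc ext_inlZ; congr (ext_inr _); exact: esym (linearZZ x _ _).
rewrite (_ : \sum_i _ = 0) ?raddf0 ?mulr0 //; apply: val_inj.
rewrite [LHS]cval_sum -[RHS]ta0.
by apply: eq_bigr => i _; rewrite tc.
Qed.

(* The R-linear extension R (x)_S R = R (x)_C A -> R (x)_C D of x. *)
Definition point_ext (z : tens_sq R) : T := point_sum (sval (cid (tens_sq_repr z))).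

Lemma point_extE (L : seq (R * A)) :
  point_ext (\sum_(p <- L) iotal p.1 * cval p.2) = point_sum L.
Proof.
rewrite /point_ext; set z := \sum_(p <- L) _; case: cid => L' /= zL'.
apply/eqP; rewrite -subr_eq0; apply/eqP.
have <- : point_sum (L' ++ [seq (- p.1, p.2) | p <- L]) = point_sum L' - point_sum L.
  rewrite /point_sum big_cat big_map -sumrN; congr (_ + _).
  by apply: eq_bigr => p _; rewrite rmorphN mulNr.
apply: point_sum_eq0; rewrite big_cat big_map -zL' /z -[RHS](subrr z); congr (_ + _).
by rewrite -sumrN; apply: eq_bigr => p _; rewrite rmorphN mulNr.
Qed.

Lemma point_extD : {morph point_ext : y z / y + z}.
Proof.
move=> y z; have [L ->] := tens_sq_repr y; have [L' ->] := tens_sq_repr z.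
by rewrite -big_cat !point_extE /point_sum big_cat.
Qed.

Lemma point_extM : {morph point_ext : y z / y * z}.
Proof.
move=> y z; have [L ->] := tens_sq_repr y; have [L' ->] := tens_sq_repr z.
rewrite !point_extE /point_sum !big_distrlr /=.
have := point_extE [seq (p.1 * q.1, p.2 * q.2) | p <- L, q <- L'].
rewrite /point_sum !big_allpairs_dep /= => pE.
transitivity (\sum_(p <- L) \sum_(q <- L') ext_inl (p.1 * q.1) * ext_inr (x (p.2 * q.2))).
  rewrite -pE; congr point_ext; apply: eq_bigr => p _; apply: eq_bigr => q _.
  by rewrite rmorphM mulrACA.
by apply: eq_bigr => p _; apply: eq_bigr => q _; rewrite !rmorphM mulrACA.
Qed.

Lemma point_ext_term r (a : A) : point_ext (iotal r * cval a) = ext_inl r * ext_inr (x a).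
Proof.
by have := point_extE [:: (r, a)]; rewrite /point_sum !big_seq1.
Qed.

Lemma point_ext_inl r : point_ext (iotal r) = ext_inl r.
Proof. by rewrite -[iotal r]mulr1 (point_ext_term r 1) !rmorph1 mulr1. Qed.

Lemma point_ext_const a : point_ext (cval a) = ext_inr (x a).
Proof.
by rewrite -[cval a]mul1r -(rmorph1 (@iotal S R)) point_ext_term !rmorph1 mul1r.
Qed.

Lemma point_ext_ider : commutes_ider point_ext.
Proof.
move=> n z; have [L ->] := tens_sq_repr z; rewrite point_extE ider_sum.
have := point_extE [seq (ider n p.1, p.2) | p <- L].
rewrite /point_sum !big_map => pE.
transitivity (\sum_(p <- L) ext_inl (ider n p.1) * ext_inr (x p.2)).
  rewrite -pE; congr point_ext; apply: eq_bigr => p _.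
  rewrite (ider_mul_const (@iotal_ider S R)) //; exact/idconstP/cvalP.
rewrite ider_sum; apply: eq_bigr => p _.
by rewrite (ider_mul_const ext_inl_ider) //; exact: ext_inr_const.
Qed.

Lemma point_ext_sum (I : Type) (s : seq I) (F : I -> tens_sq R) :
  point_ext (\sum_(i <- s) F i) = \sum_(i <- s) point_ext (F i).
Proof.
apply: (big_morph _ point_extD).
by apply: (addIr (point_ext 0)); rewrite -point_extD !add0r.
Qed.

Let endo_bal : balanced_map
  (fun (r : overC R) (d : trivID D) => point_ext (iotar (r : R)) * ext_inr d).
Proof.
split=> [d r s|r d d'|c r d].
- by rewrite -mulrDl -point_extD -rmorphD.
- by rewrite rmorphD mulrDr.
rewrite [iotar _](_ : _ = iotal (cval c)%:A * iotar (r : R)); last exact: iotarZ.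
by rewrite point_extM point_ext_inl mulrAC mulrC ext_inlZ.
Qed.

(** The coaction r |-> 1 (x) r from R to R (x)_C A, pushed along [x] and extended [D]-linearly. *)
Definition point_endo (t : T) : T :=
  tens_lift (fun (r : overC R) (d : trivID D) => point_ext (iotar (r : R)) * ext_inr d) t.

Lemma point_endo_pure (r : R) (d : D) :
  point_endo (ext_inl r * ext_inr d) = point_ext (iotar r) * ext_inr d.
Proof. by rewrite -ext_inlr; exact: (tens_lift_pure endo_bal). Qed.

Lemma point_endoD : {morph point_endo : y z / y + z}.
Proof. exact: (tens_liftD endo_bal). Qed.

Lemma point_endo_inl (r : R) : point_endo (ext_inl r) = point_ext (iotar r).
Proof. by have := point_endo_pure r 1; rewrite rmorph1 !mulr1. Qed.

Fact point_endo_zmod : zmod_morphism point_endo.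
Proof. by move=> y z; apply: (addIr (point_endo z)); rewrite -point_endoD !subrK. Qed.

Fact point_endo_monoid : monoid_morphism point_endo.
Proof.
split=> [|y z].
  rewrite -[X in point_endo X](rmorph1 ext_inl) point_endo_inl.
  by rewrite [iotar 1](_ : _ = iotal 1) // point_ext_inl rmorph1.
elim/tens_ind: y => [r d|y y' IHy IHy']; last first.
  by rewrite mulrDl !point_endoD IHy IHy' mulrDl.
elim/tens_ind: z => [s d'|z z' IHz IHz']; last first.
  by rewrite mulrDr !point_endoD IHz IHz' mulrDr.
rewrite -![pure _ _]/(epure _ _) !ext_inlr mulrACA -!rmorphM !point_endo_pure.
by rewrite !rmorphM point_extM mulrACA.
Qed.

HB.instance Definition _ := GRing.isZmodMorphism.Build T T point_endo point_endo_zmod.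
HB.instance Definition _ := GRing.isMonoidMorphism.Build T T point_endo point_endo_monoid.

Lemma point_endo_ider : commutes_ider point_endo.
Proof.
move=> n t; elim/tens_ind: t => [r d|y z IHy IHz]; last first.
  by rewrite iderD !point_endoD IHy IHz iderD.
rewrite -[pure _ _]/(epure _ _) ext_inlr (ider_mul_const ext_inl_ider); last exact: ext_inr_const.
rewrite !point_endo_pure iotar_ider point_ext_ider [RHS]iderM.
rewrite cauchyC cauchy_l0 ?ext_inr_const //= => -[|i] j // _.
by rewrite ext_inr_const mulr0.
Qed.

Lemma point_endo_scal (s : S) d t :
  point_endo (ext_inl s%:A * ext_inr d * t) = ext_inl s%:A * ext_inr d * point_endo t.
Proof. by rewrite rmorphM /= point_endo_pure iotar_alg point_ext_inl. Qed.

Lemma point_endo_lin u t :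
  point_endo (scalar_ext_str R u * t) = scalar_ext_str R u * point_endo t.
Proof.
elim/tens_ind: u => [s d|u w IHu IHw]; last first.
  have strD : {morph @scalar_ext_str S R D : x y / x + y}.
    apply: tens_mapD => //; first exact: (@scalerDl S R 1).
    by move=> k a; exact: (esym (scalerA (cval k) (a : S) (1 : R))).
  by rewrite strD !mulrDl point_endoD IHu IHw.
rewrite -[pure s d]/(tpure (s : overC S^o) d) -epure_str ext_inlr.
exact: point_endo_scal.
Qed.

Definition point_idaut : idaut R D := IDAut
  (endo_bij point_endo_ider point_endo_scal) point_endo_ider point_endo_lin.
End PointToEndo.

Lemma endo_scal_idaut (F : idaut R D) (s : S) d t :
  F (ext_inl s%:A * ext_inr d * t) = ext_inl s%:A * ext_inr d * F t.
Proof. by rewrite -ext_inlr; exact: idaut_scal. Qed.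

(** A constant [a] is a sum of tensors r (x) r', and [point_ext x] sends each to [ext_inl r] times
    the value of the automorphism at r'; so the automorphism determines [x a] inside R (x)_C D,
    where [D] embeds. *)
Lemma point_idaut_inj : injective point_idaut.
Proof.
move=> x y xy; apply: lrmorphismP => a; apply: ext_inr_inj.
rewrite -!point_ext_const.
have [L ->] : exists L : seq (R * R), cval a = \sum_(p <- L) iotal p.1 * iotar p.2.
  elim/tens_ind: (cval a) => [r r'|z z' [L ->] [L' ->]]; last by exists (L ++ L'); rewrite big_cat.
  by exists [:: (r, r')]; rewrite big_seq1 iota_tpure.
rewrite !point_ext_sum; apply: eq_bigr => p _; rewrite !point_extM !point_ext_inl.
by rewrite -!point_endo_inl -[point_endo x _]/(point_idaut x _) xy.
Qed.

Section IdautToPoint.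
Variable F : idaut R D.
Let F_scal := endo_scal_idaut F.

Definition idaut_point (a : A) : D :=
  sval (cid (endo_ext_const (@idaut_ider _ _ _ F) F_scal a)).

Lemma idaut_pointP a : endo_ext F (cval a) = ext_inr (idaut_point a).
Proof. by rewrite /idaut_point; case: cid. Qed.

Fact idaut_point_zmod : zmod_morphism idaut_point.
Proof.
move=> a b; apply: ext_inr_inj; rewrite rmorphB /= -!idaut_pointP.
apply: (addIr (endo_ext F (cval b))); rewrite subrK -(endo_extD F_scal).
congr (endo_ext F _); exact: subrK.
Qed.

Fact idaut_point_monoid : monoid_morphism idaut_point.
Proof.
split=> [|a b]; apply: ext_inr_inj.
  rewrite rmorph1 -idaut_pointP [cval 1](_ : _ = iotal 1) ?rmorph1 //.
  by rewrite (endo_ext_inl F_scal) rmorph1.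
by rewrite rmorphM /= -!idaut_pointP -(endo_extM F_scal).
Qed.

Fact idaut_point_scalable : scalable idaut_point.
Proof.
move=> c a; apply: ext_inr_inj; rewrite -ext_inlZ -!idaut_pointP.
by rewrite -(endo_ext_inl F_scal) -(endo_extM F_scal).
Qed.

HB.instance Definition _ := GRing.isZmodMorphism.Build A D idaut_point idaut_point_zmod.
HB.instance Definition _ := GRing.isMonoidMorphism.Build A D idaut_point idaut_point_monoid.
HB.instance Definition _ :=
  GRing.isScalable.Build C A D *:%R idaut_point idaut_point_scalable.

Lemma point_idautK : point_idaut (idaut_point : {lrmorphism A -> D}) = F.
Proof.
set x : {lrmorphism A -> D} := idaut_point.
apply: idautP => t; elim/tens_ind: t => [r d|t u IHt IHu]; last first.
  by rewrite !rmorphD IHt IHu.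
rewrite -[pure _ _]/(epure _ _) ext_inlr -[LHS]/(point_endo x _) point_endo_pure.
rewrite [RHS]rmorphM (endo_inr F_scal); congr (_ * _).
(* What remains compares two multiplicative extensions to R (x)_S R; they agree on the left factor
   and on the constants, which together generate it. *)
rewrite -(endo_ext_inr F_scal); move: (@iotar S R r) => z.
have [L ->] := tens_sq_repr z; rewrite point_ext_sum.
rewrite (big_morph _ (endo_extD F_scal) (endo_ext0 F_scal)); apply: eq_bigr => p _.
by rewrite point_ext_term (endo_extM F_scal) (endo_ext_inl F_scal) idaut_pointP.
Qed.
End IdautToPoint.

Lemma point_idaut_bij : bijective point_idaut.
Proof.
exists (fun F => (idaut_point F : {lrmorphism A -> D})) => [x|F]; last exact: point_idautK.
by apply: point_idaut_inj; rewrite point_idautK.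
Qed.

End ScalarExt.

Lemma point_idaut_natural (D E : comAlgType C) (u : {lrmorphism D -> E})
    (x : {lrmorphism A -> D}) :
  point_idaut (u \o x : {lrmorphism A -> E}) = idaut_map u (point_idaut x).
Proof.
apply: idautP => t; elim/tens_ind: t => [r e|t t' IHt IHt']; last first.
  by rewrite !rmorphD IHt IHt'.
rewrite -[pure _ _]/(epure _ _) -[RHS]/(idaut_map_fun u (point_idaut x) _) idaut_map_pure.
rewrite -[LHS]/(point_endo (u \o x) _) ext_inlr point_endo_pure; congr (_ * _).
rewrite -[point_idaut x _]/(point_endo x (ext_inl D (r : R))) point_endo_inl.
have [L ->] := tens_sq_repr (@iotar S R r).
rewrite !point_extE /point_sum.
have ext0 : @ext_map S R D E u 0 = 0.
  by apply: (addIr (ext_map u 0)); rewrite -ext_mapD !add0r.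
rewrite (big_morph _ (ext_mapD u) ext0); apply: eq_bigr => p _.
by rewrite -!ext_inlr ext_map_pure.
Qed.
End Representability.

(** The group law is transported along the bijections [Phi D]; its naturality in [D] combines that
    of [Phi] with [gf_mapM]. *)
Lemma represents_affGroupScheme (C : comNzRingType) (A : comAlgType C) (G : groupFunctor C) :
  represents A G -> exists H : affGroupScheme A, gf_iso (points_functor H) G.
Proof.
move=> [Phi [Phi_bij Phi_nat]].
have invP D : {Psi : G D -> {lrmorphism A -> D} | cancel (Phi D) Psi & cancel Psi (Phi D)}.
  by apply: cid2; case: (Phi_bij D) => Psi PhiK PsiK; exists Psi.
pose Psi D := s2val (invP D).
have PhiK D : cancel (Phi D) (Psi D) by rewrite /Psi; case: (invP D).
have PsiK D : cancel (Psi D) (Phi D) by rewrite /Psi; case: (invP D).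
pose mul D x y := Psi D (Phi D x * Phi D y)%g.
pose inv D x := Psi D (Phi D x)^-1%g.
pose one D := Psi D 1%g.
have mulA D : associative (mul D) by move=> x y z; rewrite /mul !PsiK mulgA.
have mul1 D : left_id (one D) (mul D) by move=> x; rewrite /mul /one PsiK mul1g PhiK.
have mulr1 D : right_id (one D) (mul D) by move=> x; rewrite /mul /one PsiK mulg1 PhiK.
have mulV D : left_inverse (one D) (inv D) (mul D).
  by move=> x; rewrite /mul /one /inv PsiK mulVg.
have mulrV D : right_inverse (one D) (inv D) (mul D).
  by move=> x; rewrite /mul /one /inv PsiK mulgV.
have mul_nat (D E : comAlgType C) (u : {lrmorphism D -> E}) (x y : {lrmorphism A -> D}) :
    u \o mul D x y = mul E (u \o x) (u \o y) :> {lrmorphism A -> E}.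
  apply: (can_inj (PhiK E)); rewrite Phi_nat /mul !PsiK !Phi_nat.
  exact: gf_mapM.
exists (AffGroupScheme mulA mul1 mulr1 mulV mulrV mul_nat), Phi; split=> //.
by move=> D x y; rewrite [(x * y)%g]/(mul D x y) /mul PsiK.
Qed.

Theorem corollary6p4 (S : idRingType) (R : idAlgType S) :
  idsimple S -> PV_extension R ->
  represents (consts (tens_sq R) : comAlgType (consts S)) (AutID R) /\
  exists G : affGroupScheme (consts (tens_sq R) : comAlgType (consts S)),
    gf_iso (points_functor G) (AutID R) /\
    finite_type (consts (tens_sq R) : comAlgType (consts S)).
Proof.
move=> simpleS /(PV_torsor simpleS)[simpleR constR genR ft].
have repA : represents (consts (tens_sq R) : comAlgType (consts S)) (AutID R).
  exists (fun D x => point_idaut simpleR constR genR x).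
  split=> [D|D E u x]; first exact: point_idaut_bij.
  exact: point_idaut_natural.
split=> //; have [G isoG] := represents_affGroupScheme repA.
by exists G.
Qed.
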